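(* Let $(P,Q)$ be a quasi-projection pair on a Hilbert $C^*$-module $\mathscr{H}$. Let $T_1=P(I-Q)$ and $T_2=(I-P)Q$. Then $$\mathcal{R}(\lambda_1T_1+\lambda_2T_2)=\mathcal{R}(T_1)+\mathcal{R}(T_2),\quad \forall \lambda_1,\lambda_2\in\mathbb{C}\setminus\{0\}.$$ Furthermore, the following statements are equivalent: (i) $(P,Q)$ is semi-harmonious; (ii) for all $\lambda_1,\lambda_2\in\mathbb{C}\setminus\{0\}$, $\overline{\mathcal{R}(\lambda_1T_1+\lambda_2T_2)}$ is orthogonally complemented in $\mathscr{H}$; (iii) there exist $\lambda_1,\lambda_2\in\mathbb{C}\setminus\{0\}$ such that $\overline{\mathcal{R}(\lambda_1T_1+\lambda_2T_2)}$ is orthogonally complemented in $\mathscr{H}$.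
   Context: $\mathfrak{A}$ is a $C^*$-algebra and $\mathscr{H}$ is a (right) Hilbert $\mathfrak{A}$-module; $\mathcal{L}(\mathscr{H})$ is the $C^*$-algebra of adjointable operators on $\mathscr{H}$, and $I$ is the identity operator on $\mathscr{H}$. For $T\in\mathcal{L}(\mathscr{H})$, $\mathcal{R}(T)$ and $T^*$ denote its range and adjoint, and $|T|=(T^*T)^{1/2}$; the bar denotes norm closure. An idempotent is $Q\in\mathcal{L}(\mathscr{H})$ with $Q^2=Q$; a projection is a self-adjoint idempotent. A closed submodule $\mathscr{M}$ of $\mathscr{H}$ is orthogonally complemented in $\mathscr{H}$ if $\mathscr{H}=\mathscr{M}+\mathscr{M}^\perp$, where $\mathscr{M}^\perp=\{x\in\mathscr{H}:\langle x,y\rangle=0\ \forall y\in\mathscr{M}\}$; then $P_{\mathscr{M}}$ denotes the projection from $\mathscr{H}$ onto $\mathscr{M}$. $T\in\mathcal{L}(\mathscr{H})$ has the polar decomposition if there is a partial isometry $U\in\mathcal{L}(\mathscr{H})$ with $T=U|T|$ and $U^*U=P_{\overline{\mathcal{R}(T^* )}}$ (in particular $\overline{\mathcal{R}(T^* )}$ is orthogonally complemented). A quasi-projection pair $(P,Q)$ on $\mathscr{H}$ consists of a projection $P\in\mathcal{L}(\mathscr{H})$ and an idempotent $Q\in\mathcal{L}(\mathscr{H})$ such that $PQ^*P=PQP$, $PQ^*(I-P)=-PQ(I-P)$ and $(I-P)Q^*(I-P)=(I-P)Q(I-P)$; equivalently, $Q^*=(2P-I)Q(2P-I)$. A quasi-projection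 pair $(P,Q)$ is semi-harmonious if both $P(I-Q)$ and $(I-P)Q$ have the polar decomposition. *)

(* Defs.v *)
From HB Require Import structures.
From mathcomp Require Import all_boot all_order all_algebra.
From mathcomp Require Import boolp classical_sets functions reals topology.
From mathcomp Require Import normedtype complex.

Set Implicit Arguments.
Unset Strict Implicit.
Unset Printing Implicit Defensive.

Import Order.TTheory GRing.Theory Num.Theory.
Import numFieldNormedType.Exports.

Local Open Scope classical_set_scope.
Local Open Scope ring_scope.

(* C*-algebras are not assumed to be unital, whence a multiplication [cmul]
   that does not come from a ring structure.  The norm takes its values in the
   nonnegative real elements of R[i]. *)
HB.mixin Record isCStarAlgebra (R : realType) A
    of CompleteNormedModule R[i] A := {
  cmul : A -> A -> A;
  star : A -> A;
  cmulA : associative cmul;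
  cmulDl : forall a b c : A, cmul (a + b) c = cmul a c + cmul b c;
  cmulDr : forall a b c : A, cmul a (b + c) = cmul a b + cmul a c;
  cmulZl : forall (k : R[i]) (a b : A), cmul (k *: a) b = k *: cmul a b;
  cmulZr : forall (k : R[i]) (a b : A), cmul a (k *: b) = k *: cmul a b;
  starK : involutive star;
  starD : forall a b : A, star (a + b) = star a + star b;
  starZ : forall (k : R[i]) (a : A), star (k *: a) = k^* *: star a;
  starM : forall a b : A, star (cmul a b) = cmul (star b) (star a);
  norm_cmul : forall a b : A, `|cmul a b| <= `|a| * `|b|;
  norm_cstar : forall a : A, `|cmul (star a) a| = `|a| ^+ 2 }.

#[short(type="cstarAlgType")]
HB.structure Definition CStarAlgebra (R : realType) :=
  {A of isCStarAlgebra R A & CompleteNormedModule R[i] A}.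

(* The positive elements of a C*-algebra are its elements b^* b; [positive]
   below is the same notion in L(H). *)
Definition cpositive (R : realType) (A : cstarAlgType R) (a : A) : Prop :=
  exists b : A, a = cmul (star b) b.

(* Right Hilbert modules; the inner product is conjugate-linear in its first
   variable. *)
HB.mixin Record isHilbertModule (R : realType) (A : cstarAlgType R) H
    of CompleteNormedModule R[i] H := {
  ract : H -> A -> H;
  inner : H -> H -> A;
  ractDl : forall (x y : H) (a : A), ract (x + y) a = ract x a + ract y a;
  ractDr : forall (x : H) (a b : A), ract x (a + b) = ract x a + ract x b;
  ractA : forall (x : H) (a b : A), ract x (cmul a b) = ract (ract x a) b;
  ractZl : forall (k : R[i]) (x : H) (a : A), ract (k *: x) a = k *: ract x a;
  ractZr : forall (k : R[i]) (x : H) (a : A), ract x (k *: a) = k *: ract x a;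
  innerDr : forall x y z : H, inner x (y + z) = inner x y + inner x z;
  innerZr : forall (k : R[i]) (x y : H), inner x (k *: y) = k *: inner x y;
  inner_ract : forall (x y : H) (a : A), inner x (ract y a) = cmul (inner x y) a;
  inner_star : forall x y : H, star (inner x y) = inner y x;
  inner_ge0 : forall x : H, cpositive (inner x x);
  inner_eq0 : forall x : H, inner x x = 0 -> x = 0;
  norm_inner : forall x : H, `|x| ^+ 2 = `|inner x x| }.

#[short(type="hilbertModType")]
HB.structure Definition HilbertModule (R : realType) (A : cstarAlgType R) :=
  {H of isHilbertModule R A H & CompleteNormedModule R[i] H}.

Section AdjointableOperators.
Variables (R : realType) (A : cstarAlgType R) (H : hilbertModType A).
Implicit Types x y z : H.

Definition is_adjoint (T S : H -> H) : Prop :=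
  forall x y, inner (T x) y = inner x (S y).

Definition adjointable : {pred H -> H} :=
  [pred T : H -> H | `[< exists S : H -> H, is_adjoint T S >]].

Lemma innerDl x y z : inner (x + y) z = inner x z + inner y z.
Proof. by rewrite -inner_star innerDr starD !inner_star. Qed.

Lemma innerZl (k : R[i]) x y : inner (k *: x) y = k^* *: inner x y.
Proof. by rewrite -inner_star innerZr starZ inner_star. Qed.

Lemma inner0r x : inner x 0 = 0.
Proof. by rewrite -(scale0r 0) innerZr scale0r. Qed.

Lemma inner0l x : inner 0 x = 0.
Proof. by rewrite -(scale0r 0) innerZl conjC0 scale0r. Qed.

Lemma innerNr x y : inner x (- y) = - inner x y.
Proof. by rewrite -scaleN1r innerZr scaleN1r. Qed.

Lemma inner_injl x y : (forall z, inner z x = inner z y) -> x = y.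
Proof.
move=> xy; apply/eqP; rewrite -subr_eq0; apply/eqP/inner_eq0.
by rewrite innerDr innerNr xy subrr.
Qed.

Lemma adjointable_linear (T : H -> H) : T \in adjointable ->
  forall (k : R[i]) x y, T (k *: x + y) = k *: T x + T y.
Proof.
move=> /asboolP[S TS] k x y; apply: inner_injl => z.
by rewrite -inner_star TS inner_star innerDr innerDr !innerZr
  -!(inner_star (T _)) !TS !inner_star.
Qed.

Lemma adjointable_submod : submod_closed adjointable.
Proof.
split=> [|k T1 T2 /asboolP[S1 TS1] /asboolP[S2 TS2]].
  apply/asboolP; exists (fun=> 0) => x y.
  by rewrite inner0l inner0r.
apply/asboolP; exists (fun y => k^* *: S1 y + S2 y) => x y.
by rewrite innerDl innerZl innerDr innerZr TS1 TS2.
Qed.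

HB.instance Definition _ :=
  GRing.isSubmodClosed.Build R[i] (H -> H) adjointable adjointable_submod.

Lemma adjointable_id : idfun \in adjointable.
Proof. by apply/asboolP; exists idfun. Qed.

Lemma adjointable_comp (T1 T2 : H -> H) :
  T1 \in adjointable -> T2 \in adjointable -> T1 \o T2 \in adjointable.
Proof.
move=> /asboolP[S1 TS1] /asboolP[S2 TS2]; apply/asboolP.
by exists (S2 \o S1) => x y; rewrite /= TS1 TS2.
Qed.

(* The C*-algebra L(H) of adjointable operators on H. *)
Record adjop := AdjOp { adjop_fun :> H -> H; _ : adjop_fun \in adjointable }.

HB.instance Definition _ := [isSub for adjop_fun].
HB.instance Definition _ := [Choice of adjop by <:].
HB.instance Definition _ := [SubChoice_isSubLmodule of adjop by <:].

Implicit Types T S U E P Q : adjop.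

Lemma adjopP T S : (forall x, T x = S x) -> T = S.
Proof. by move=> TS; apply: val_inj; apply/funext. Qed.

Lemma adjop_linear T (k : R[i]) x y : T (k *: x + y) = k *: T x + T y.
Proof. exact: adjointable_linear (valP T) k x y. Qed.

(* The product of L(H) is the composition of operators. *)
Definition adjop_one : adjop := AdjOp adjointable_id.
Definition adjop_mul T S : adjop := AdjOp (adjointable_comp (valP T) (valP S)).

Fact adjop_mulA : associative adjop_mul.
Proof. by move=> T S U; apply: adjopP. Qed.

Fact adjop_mul1 : left_id adjop_one adjop_mul.
Proof. by move=> T; apply: adjopP. Qed.

Fact adjop_mulr1 : right_id adjop_one adjop_mul.
Proof. by move=> T; apply: adjopP. Qed.

Fact adjop_mulDl : left_distributive adjop_mul +%R.
Proof. by move=> T S U; apply: adjopP. Qed.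

Fact adjop_mulDr : right_distributive adjop_mul +%R.
Proof.
move=> T S U; apply: adjopP => x /=.
by have := adjop_linear T 1 (S x) (U x); rewrite !scale1r.
Qed.

HB.instance Definition _ := GRing.Zmodule_isPzRing.Build adjop
  adjop_mulA adjop_mul1 adjop_mulr1 adjop_mulDl adjop_mulDr.

Lemma adjop_adjoint_ex T : exists S : adjop, is_adjoint T S.
Proof.
have /asboolP[S TS] := valP T.
suff S_adj : S \in adjointable by exists (AdjOp S_adj).
apply/asboolP; exists T => x y.
by rewrite -inner_star -TS inner_star.
Qed.

Definition adj T : adjop := projT1 (cid (adjop_adjoint_ex T)).

Lemma adjE T x y : inner (T x) y = inner x (adj T y).
Proof. exact: (projT2 (cid (adjop_adjoint_ex T))). Qed.

Definition idempotent T : Prop := T * T = T.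

Definition projection T : Prop := idempotent T /\ adj T = T.

Definition positive T : Prop := exists S, T = adj S * S.

(* [is_abs T S] : S is the positive square root |T| of T^* T. *)
Definition is_abs T S : Prop := positive S /\ S * S = adj T * T.

Definition partial_isometry U : Prop := U * adj U * U = U.

Definition set_add (M N : set H) : set H := [set x + y | x in M & y in N].

Definition orthocompl (M : set H) : set H :=
  [set x | forall y, M y -> inner x y = 0].

Definition closed_submodule (M : set H) : Prop :=
  [/\ closed M, M 0,
      forall (k : R[i]) x y, M x -> M y -> M (k *: x + y) &
      forall x (a : A), M x -> M (ract x a)].

Definition orthocomplemented (M : set H) : Prop :=
  closed_submodule M /\ set_add M (orthocompl M) = setT.

(* [is_proj_onto M E] : E is the projection P_M of H onto M. *)
Definition is_proj_onto (M : set H) E : Prop := projection E /\ range E = M.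

Definition has_polar_decomposition T : Prop :=
  let M := closure (range (adj T)) in
  orthocomplemented M /\
  exists U S : adjop, [/\ partial_isometry U, is_abs T S, T = U * S &
                          is_proj_onto M (adj U * U)].

Definition quasi_projection_pair P Q : Prop :=
  [/\ projection P, idempotent Q,
      P * adj Q * P = P * Q * P,
      P * adj Q * (1 - P) = - (P * Q * (1 - P)) &
      (1 - P) * adj Q * (1 - P) = (1 - P) * Q * (1 - P)].

Definition semi_harmonious P Q : Prop :=
  has_polar_decomposition (P * (1 - Q)) /\
  has_polar_decomposition ((1 - P) * Q).

End AdjointableOperators.

(* Main.v *)
Require Import Defs.
From HB Require Import structures.
From mathcomp Require Import all_boot all_order all_algebra.
From mathcomp Require Import boolp classical_sets functions reals topology.
From mathcomp Require Import normedtype complex.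
From mathcomp Require Import sequences.
From mathcomp Require Import ring lra.
Import numFieldNormedType.Exports.
Local Open Scope classical_set_scope.
Local Open Scope ring_scope.

(** Put [W = T1 + T2 = P (1 - Q) + (1 - P) Q].  Everything follows from a few
    algebraic identities for [W] and from general facts on Hilbert modules.

    Since [Q (1 - Q) = (1 - Q) Q = 0], the vector [l1^-1 (1 - Q) x + l2^-1 Q y]
    is mapped by [l1 T1 + l2 T2] to [T1 x + T2 y], which gives the range formula.
    So the closure of the range of [l1 T1 + l2 T2] does not depend on [l1] and
    [l2], (ii) and (iii) are the same assertion, and both say that the closure
    [M] of the range of [W] is orthogonally complemented.

    If [T1] and [T2] have polar decompositions, the closures of their ranges are
    the ranges of projections [E1] and [E2] ([U U^*] for the partial isometry
    [U] of each decomposition).  As [P E1 = E1] and [P E2 = 0], the operator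
    [E1 + E2] is a projection, and its range is [M]
    ([orthocomplemented_diag]).

    Conversely, the three relations between [Q] and [Q^*] that define a
    quasi-projection pair say exactly that [W] is self-adjoint
    ([quasi_projection_sum_selfadjoint]), whence
    [P W = W (1 - Q) = T1], [(1 - P) W = W Q = T2],
    [(1 - Q)^* W = W P = T1^*] and [Q^* W = W (1 - P) = T2^*].  In each case an
    idempotent [B] satisfies [B W = W C]; then [B] leaves [M] invariant, so that
    [B E] is an idempotent, where [E] is the projection onto [M], and the range
    of [B E] is the closure of the range of [B W]
    ([orthocomplemented_range_mul]).  The range of an adjointable idempotent is
    orthogonally complemented ([idempotent_orthocomplemented]), although the
    idempotent need not be self-adjoint.  Hence the closures of the ranges of
    [T1], [T1^*], [T2] and [T2^*] are all complemented, and this is sufficient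
    for polar decompositions to exist ([polar_decomposition]).

    The general facts rest on positivity in the C*-algebra L(H): the
    Cauchy-Schwarz inequality, the existence of [|T|], and the surjectivity of
    [1 + X^* X].  They are obtained without spectral theory.  The square root
    of [1 - y] for [y] self-adjoint and [||y|| <= 1] is [1 - w], where [w] is the
    limit of the iteration [w' = (y + w^2) / 2] ([op_one_sub_sqrt]).  It turns a
    self-adjoint contraction [k] into the real part of the unitary
    [k + i sqrt (1 - k^2)], and this gives [||1 - k^2|| <= 1].  So squares of
    self-adjoint operators are positive in the metric sense
    [||c - h|| <= c], which is stable under sums, and Kaplansky's argument
    extends this to all [T^* T] ([pos_op_cstar]).  These results are first
    proved for modules that satisfy the Cauchy-Schwarz inequality.  The
    algebra [A], as a module over itself, does so trivially, and positivity of
    the left multiplications of [A] then yields the Cauchy-Schwarz inequality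
    in every Hilbert [A]-module ([hilbertmod_cauchy_schwarz]). *)

Set Implicit Arguments.
Unset Strict Implicit.
Unset Printing Implicit Defensive.
Import Order.TTheory GRing.Theory Num.Theory.
Local Open Scope complex_scope.

(** * Real-valued norms and telescoping sequences *)

Section RealNorm.
Variables (R : realType) (V : normedModType R[i]).
Implicit Types (x y : V) (r : R).

(** The norm takes its values in [R[i]], which is only partially ordered;
    inequalities between norms are handled in [R]. *)
Definition rnorm x : R := complex.Re `|x|.

Lemma rnormE x : `|x| = (rnorm x)%:C.
Proof. by rewrite RRe_real // normr_real. Qed.

Lemma rnorm_ge0 x : 0 <= rnorm x.
Proof. by rewrite -ler0c -rnormE. Qed.

Lemma rnorm0 : rnorm 0 = 0.
Proof. by rewrite /rnorm normr0. Qed.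

Lemma rnorm_eq0 x : rnorm x = 0 -> x = 0.
Proof. by move=> x0; apply/eqP; rewrite -normr_eq0 rnormE x0. Qed.

Lemma rnormN x : rnorm (- x) = rnorm x.
Proof. by rewrite /rnorm normrN. Qed.

Lemma rnormB x y : rnorm (x - y) = rnorm (y - x).
Proof. by rewrite /rnorm distrC. Qed.

Lemma rnormD x y : rnorm (x + y) <= rnorm x + rnorm y.
Proof. by rewrite -lecR rmorphD /= -!rnormE ler_normD. Qed.

Lemma rnormD3 y x z : rnorm (x - z) <= rnorm (x - y) + rnorm (y - z).
Proof. by rewrite -{1}(subrK y x) -addrA rnormD. Qed.

Lemma rnormZ r x : rnorm (r%:C *: x) = `|r| * rnorm x.
Proof.
have /(congr1 (@complex.Re R)) := normrZ r%:C x; rewrite -/(rnorm _) => ->.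
by rewrite normc_def /= expr0n addr0 sqrtr_sqr rnormE -rmorphM.
Qed.

Lemma rnorm_le0 x : (forall e : R, 0 < e -> rnorm x < e) -> x = 0.
Proof.
move=> xe; apply/rnorm_eq0/le_anti; rewrite rnorm_ge0 andbT.
by apply/ler_addgt0Pl => e /xe /ltW; rewrite addr0.
Qed.

Lemma cvg_rnorm (u : nat -> V) (l : V) :
  u @ \oo --> l <->
  forall e : R, 0 < e -> \forall n \near \oo, rnorm (l - u n) < e.
Proof.
split=> [/cvgrPdist_lt ul e e0|ul].
  by have := ul e%:C; rewrite ltcR => /(_ e0); apply: filterS => n; rewrite rnormE ltcR.
apply/cvgrPdist_lt => e e0.
have er : e = (complex.Re e)%:C by rewrite RRe_real // gtr0_real.
rewrite er ltcR in e0 *; apply: filterS (ul _ e0) => n.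
by rewrite rnormE ltcR.
Qed.

Lemma closure_rnorm (M : set V) (x : V) :
  closure M x <-> forall e : R, 0 < e -> exists2 y, M y & rnorm (x - y) < e.
Proof.
split=> [clMx e e0|Mx].
  have [|y [My xy]] := clMx [set y | rnorm (x - y) < e]; last by exists y.
  apply/nbhs_normP; exists e%:C => /=; first by rewrite ltcR.
  by move=> y /=; rewrite rnormE ltcR.
move=> B /nbhs_normP[e /= e0 Be].
have er : e = (complex.Re e)%:C by rewrite RRe_real // gtr0_real.
rewrite er ltcR in e0 Be; have [y My xy] := Mx _ e0.
by exists y; split=> //; apply: Be; rewrite /= rnormE ltcR.
Qed.

End RealNorm.

(** The increments of [u] are dominated by those of a bounded nondecreasing
    real sequence [t], so [u] is Cauchy; the distance from [u n] to the limit is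
    at most the remaining growth of [t]. *)
Lemma cvg_telescope (R : realType) (V : completeNormedModType R[i])
    (u : nat -> V) (t : nat -> R) (b : R) :
  (forall n, rnorm (u n.+1 - u n) <= t n.+1 - t n) -> (forall n, t n <= b) ->
  exists2 l, u @ \oo --> l & forall n, rnorm (l - u n) <= b - t n.
Proof.
move=> ut tb.
have tS n k : rnorm (u (n + k)%N - u n) <= t (n + k)%N - t n.
  elim: k => [|k IHk]; first by rewrite addn0 !subrr rnorm0.
  have := rnormD3 (u (n + k)%N) (u (n + k.+1)%N) (u n).
  by have := ut (n + k)%N; rewrite addnS => ? ?; lra.
have t_nd : nondecreasing_seq t.
  by apply/nondecreasing_seqP => n; rewrite -subr_ge0 (le_trans (rnorm_ge0 _) (ut n)).
have t_cvg : cvgn t.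
  by apply: nondecreasing_is_cvgn => //; exists b => _ [n _ <-].
have /cvg_ex[l ul] : cvgn u.
  apply/cauchy_cvgP/cauchy_exP => e e0.
  have er : e = (complex.Re e)%:C by rewrite RRe_real // gtr0_real.
  move: e0; rewrite er ltcR; set d := complex.Re e => d0.
  have [N _ tN] := (cvgrPdist_lt _ _).1 t_cvg _ d0.
  exists (u N); exists N => // n /= Nn; rewrite -ball_normE /= rnormE ltcR rnormB.
  rewrite -(subnKC Nn) (le_lt_trans (tS _ _)) // subnKC //.
  have := tN N (leqnn _); rewrite /= ger0_norm ?subr_ge0; last first.
    exact: nondecreasing_cvgn_le.
  by apply: le_lt_trans; rewrite lerD2r nondecreasing_cvgn_le.
exists l => // n; apply/ler_addgt0Pl => e /((cvg_rnorm _ _).1 ul) [N _ uN].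
have := uN (maxn N n) (leq_maxl _ _).
have := tS n (maxn N n - n)%N; rewrite subnKC ?leq_maxr // => ? ?.
have := rnormD3 (u (maxn N n)) l (u n); have := tb (maxn N n); lra.
Qed.

(** * The algebra of adjointable operators *)

Section OperatorAlgebra.
Variables (R : realType) (A : cstarAlgType R) (H : hilbertModType A).
Implicit Types (x y z : H) (T S B : adjop H) (k : R[i]).

Lemma innerNl x y : inner (- x) y = - inner x y.
Proof. by rewrite -inner_star innerNr -scaleN1r starZ rmorphN1 scaleN1r inner_star. Qed.

Lemma inner_ractl x y (a : A) : inner (ract x a) y = cmul (star a) (inner x y).
Proof. by rewrite -inner_star inner_ract starM inner_star. Qed.

HB.instance Definition _ T :=
  GRing.isLinear.Build R[i] H H *:%R T (adjop_linear T).

Lemma adjopMx T S x : (T * S) x = T (S x). Proof. by []. Qed.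
Lemma adjopDx T S x : (T + S) x = T x + S x. Proof. by []. Qed.
Lemma adjopNx T x : (- T) x = - T x. Proof. by []. Qed.
Lemma adjopZx k T x : (k *: T) x = k *: T x. Proof. by []. Qed.
Lemma adjop1x x : (1 : adjop H) x = x. Proof. by []. Qed.
Lemma adjop0x x : (0 : adjop H) x = 0. Proof. by []. Qed.

Lemma adjopZl k T S : (k *: T) * S = k *: (T * S).
Proof. exact: adjopP. Qed.

Lemma adjopZr k T S : T * (k *: S) = k *: (T * S).
Proof. by apply: adjopP => x; rewrite adjopMx !adjopZx linearZ. Qed.

Lemma adj_unique T S : is_adjoint T S -> adj T = S.
Proof. by move=> TS; apply: adjopP => y; apply: inner_injl => x; rewrite -adjE TS. Qed.

Lemma adjK T : adj (adj T) = T.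
Proof. by apply: adj_unique => x y; rewrite -inner_star -adjE inner_star. Qed.

Lemma adjEl T x y : inner (adj T x) y = inner x (T y).
Proof. by rewrite adjE adjK. Qed.

Lemma adjM T S : adj (T * S) = adj S * adj T.
Proof. by apply: adj_unique => x y; rewrite !adjopMx !adjE. Qed.

Lemma adjD T S : adj (T + S) = adj T + adj S.
Proof. by apply: adj_unique => x y; rewrite !adjopDx innerDl innerDr !adjE. Qed.

Lemma adjZ k T : adj (k *: T) = k^*%R *: adj T.
Proof. by apply: adj_unique => x y; rewrite !adjopZx innerZl innerZr !adjE. Qed.

Lemma adjZr (r : R) T : adj (r%:C *: T) = r%:C *: adj T.
Proof. by rewrite adjZ; congr (_ *: _); exact: conjc_real. Qed.

Lemma adjN T : adj (- T) = - adj T.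
Proof. by rewrite -scaleN1r adjZ rmorphN1 scaleN1r. Qed.

Lemma adjB T S : adj (T - S) = adj T - adj S.
Proof. by rewrite adjD adjN. Qed.

Lemma adj0 : adj (0 : adjop H) = 0.
Proof. by apply: adj_unique => x y; rewrite !adjop0x inner0l inner0r. Qed.

Lemma adj1 : adj (1 : adjop H) = 1.
Proof. exact: adj_unique. Qed.

Lemma rnorm_inner x : rnorm (inner x x) = rnorm x ^+ 2.
Proof.
by apply: complexI; rewrite rmorphXn /= -!rnormE norm_inner.
Qed.

Definition opbound T (c : R) := forall x, rnorm (T x) <= c * rnorm x.

Lemma opboundD T S (a b : R) :
  opbound T a -> opbound S b -> opbound (T + S) (a + b).
Proof.
by move=> Ta Sb x; rewrite adjopDx (le_trans (rnormD _ _)) // mulrDl lerD.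
Qed.

Lemma opboundM T S (a b : R) :
  0 <= a -> opbound T a -> opbound S b -> opbound (T * S) (a * b).
Proof.
move=> a0 Ta Sb x; rewrite adjopMx (le_trans (Ta _)) // -mulrA.
by rewrite ler_wpM2l.
Qed.

Lemma opboundM1 T S : opbound T 1 -> opbound S 1 -> opbound (T * S) 1.
Proof. by move=> T1 S1; have := opboundM ler01 T1 S1; rewrite mulr1. Qed.

Lemma opboundZ T (r c : R) :
  0 <= r -> opbound T c -> opbound (r%:C *: T) (r * c).
Proof.
move=> r0 Tc x; rewrite adjopZx rnormZ ger0_norm // -mulrA.
by rewrite ler_wpM2l.
Qed.

Lemma opbound_normalize T (c : R) :
  0 < c -> opbound T c -> opbound ((c^-1)%:C *: T) 1.
Proof.
move=> c0 Tc; rewrite -(mulVf (lt0r_neq0 c0)).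
by apply: opboundZ => //; rewrite invr_ge0 ltW.
Qed.

Lemma opboundN T (c : R) : opbound T c -> opbound (- T) c.
Proof. by move=> Tc x; rewrite adjopNx rnormN. Qed.

Lemma opbound1 : opbound 1 1.
Proof. by move=> x; rewrite mul1r. Qed.

Lemma opbound_le T (a b : R) : a <= b -> opbound T a -> opbound T b.
Proof. by move=> ab Ta x; rewrite (le_trans (Ta x)) // ler_wpM2r ?rnorm_ge0. Qed.

End OperatorAlgebra.

Arguments opbound {R A H}.

(** The inequality is a hypothesis of the results below until it is proved for
    all Hilbert modules, since its proof uses them for one particular module. *)
Definition cauchy_schwarz (R : realType) (A : cstarAlgType R)
    (H : hilbertModType A) :=
  forall x y : H, rnorm (inner x y) <= rnorm x * rnorm y.

Section BoundedOperators.
Variables (R : realType) (A : cstarAlgType R) (H : hilbertModType A).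
Hypothesis CS : cauchy_schwarz H.
Implicit Types (x y z : H) (T S B : adjop H) (c : R).

(** One half of the C*-identity in L(H): [||T x||^2] is the norm of
    [<x, T^* T x>]. *)
Lemma opbound_cstar T c : 0 <= c -> opbound (adj T * T) (c ^+ 2) -> opbound T c.
Proof.
move=> c0 Tc x.
rewrite -(@ler_pXn2r _ 2) ?nnegrE ?mulr_ge0 ?rnorm_ge0 //.
rewrite -rnorm_inner adjE (le_trans (CS _ _)) // exprMn [leRHS]mulrC expr2 -mulrA.
by rewrite ler_wpM2l ?rnorm_ge0 // mulrC Tc.
Qed.

Lemma opbound_adj T c : 0 <= c -> opbound T c -> opbound (adj T) c.
Proof.
move=> c0 Tc x; have [->|Tx0] := eqVneq (rnorm (adj T x)) 0.
  by rewrite mulr_ge0 ?rnorm_ge0.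
rewrite -(@ler_pM2r _ (rnorm (adj T x))) ?lt_neqAle ?rnorm_ge0 ?andbT 1?eq_sym//.
rewrite -expr2 -rnorm_inner adjEl (le_trans (CS _ _)) // mulrAC [leRHS]mulrC.
by rewrite ler_wpM2l ?rnorm_ge0.
Qed.

(** The uniform boundedness principle, by a gliding hump.  If [S = T^*] were
    unbounded, take [y n] in the unit ball with [||S (y n)|| > n 3^n].  Steps of
    length [3^-n] in the direction [+-S (y n)], with a sign that does not spoil
    the value of [<S (y n), ->], converge to a vector [l] for which
    [<S (y n), l> = <y n, T l>] is at least [n / 2] for all [n]. *)
Lemma adjop_bounded T : exists2 c, 0 < c & opbound T c.
Proof.
suff [S [TS [c c0 Sc]]] : exists S, T = adj S /\ exists2 c, 0 < c & opbound S c.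
  by exists c => //; rewrite TS; apply: opbound_adj => //; exact: ltW.
exists (adj T); rewrite adjK; split=> //; set S := adj T.
apply: contrapT => Sunb.
have /choice[y yP] n : exists y, rnorm y <= 1 /\ n%:R * 3 ^+ n < rnorm (S y).
  apply: contrapT => /forallNP yn; apply: Sunb.
  exists (n%:R * 3 ^+ n + 1); first by rewrite ltr_wpDl ?mulr_ge0 ?exprn_ge0.
  move=> y; rewrite leNgt; apply/negP => Sy.
  have y0 : 0 < rnorm y.
    rewrite lt_neqAle rnorm_ge0 andbT eq_sym; apply/eqP => /rnorm_eq0 y0.
    by move: Sy; rewrite y0 linear0 rnorm0 mulr0 ltxx.
  apply: (yn ((rnorm y)^-1%:C *: y)).
  rewrite linearZ /= !rnormZ ger0_norm ?invr_ge0 ?rnorm_ge0 //.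
  rewrite mulVf ?gt_eqF //; split=> //.
  by rewrite ltr_pdivlMl // mulrC (le_lt_trans _ Sy) // ler_wpM2r ?rnorm_ge0 ?lerDl.
have Sy0 n : 0 < rnorm (S (y n)).
  by apply: le_lt_trans (yP n).2; rewrite mulr_ge0 ?exprn_ge0.
pose v n := (rnorm (S (y n)))^-1%:C *: S (y n).
have v1 n : rnorm (v n) = 1.
  by rewrite rnormZ ger0_norm ?invr_ge0 ?rnorm_ge0 // mulVf ?gt_eqF.
pose f n x := inner (S (y n)) x.
have fv n : rnorm (f n (v n)) = rnorm (S (y n)).
  rewrite /f innerZr rnormZ ger0_norm ?invr_ge0 ?rnorm_ge0 // rnorm_inner.
  by rewrite expr2 mulKf ?gt_eqF.
have fD n x x' : f n (x + x') = f n x + f n x' by exact: innerDr.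
have fN n x : f n (- x) = - f n x by exact: innerNr.
have f_le n x : rnorm (f n x) <= rnorm (S (y n)) * rnorm x by exact: CS.
have f_leT n x : rnorm (f n x) <= rnorm (T x).
  rewrite /f adjEl (le_trans (CS _ _)) // ler_piMl ?rnorm_ge0 //.
  by have [] := yP n.
pose w n : H := (3^-1 ^+ n)%:C *: v n.
have w1 n : rnorm (w n) = 3^-1 ^+ n.
  by rewrite rnormZ v1 mulr1 ger0_norm // exprn_ge0 // invr_ge0.
have fw n : rnorm (f n (w n)) = 3^-1 ^+ n * rnorm (S (y n)).
  by rewrite /w {1}/f innerZr rnormZ -/(f _ _) fv ger0_norm // exprn_ge0 // invr_ge0.
(* One of the two signs is good because [f n (x + w) - f n (x - w)] is twice
   [f n w]. *)
pose step n x := if rnorm (f n (w n)) <= rnorm (f n (x + w n))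
                 then x + w n else x - w n.
have stepf n x : rnorm (f n (w n)) <= rnorm (f n (step n x)).
  rewrite /step; case: ifPn => //; rewrite -ltNge => lt_w.
  have : f n (x + w n) - f n (x - w n) = 2%:C *: f n (w n).
    by rewrite !fD fN opprD opprK addrACA subrr add0r rmorph_nat scaler_nat.
  move=> /(congr1 (@rnorm _ _)); rewrite rnormZ.
  have := rnormD (f n (x + w n)) (- f n (x - w n)).
  by rewrite rnormN ger0_norm // => ? ?; lra.
have stepd n x : rnorm (step n x - x) <= 3^-1 ^+ n.
  rewrite /step; case: ifP => _; rewrite addrAC subrr add0r ?rnormN w1 //.
pose fix u n := if n is m.+1 then step m (u m) else 0.
(* The tail of a geometric series of ratio 1/3: [t n.+1 - t n = 3^-n]. *)
pose t n : R := - (3 / 2 * 3^-1 ^+ n).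
have [|n|l _ ul] := @cvg_telescope _ H u t 0.
- by move=> n; rewrite (le_trans (stepd _ _)) // /t exprS; lra.
- by rewrite /t oppr_le0 mulr_ge0 ?exprn_ge0 ?invr_ge0 //; lra.
have lbd n : n%:R <= 2 * rnorm (T l).
  have := ul n.+1; have := f_leT n l; have := stepf n (u n).
  have := f_le n (l - u n.+1); have := rnormD (f n l) (- f n (l - u n.+1)).
  have -> : f n l - f n (l - u n.+1) = f n (step n (u n)).
    by rewrite fD fN opprD opprK addNKr.
  rewrite rnormN fw /t exprS => h1 h2 h3 h4 h5.
  have h6 : n%:R <= 3^-1 ^+ n * rnorm (S (y n)).
    by rewrite exprVn mulrC ler_pdivlMr ?exprn_gt0 // ltW //; case: (yP n).
  have h7 : rnorm (S (y n)) * rnorm (l - u n.+1) <= rnorm (S (y n)) * (3^-1 ^+ n / 2).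
    by rewrite ler_wpM2l ?rnorm_ge0 //; lra.
  by lra.
have := lbd (Num.truncn (2 * rnorm (T l))).+1.
by rewrite leNgt truncnS_gt.
Qed.

End BoundedOperators.

(** * Square roots in L(H) *)

Section SquareRoots.
Variables (R : realType) (A : cstarAlgType R) (H : hilbertModType A).
Hypothesis CS : cauchy_schwarz H.
Implicit Types (x : H) (T : adjop H).

Lemma cvg_adjop T (u : nat -> H) (l : H) :
  u @ \oo --> l -> T (u n) @[n --> \oo] --> T l.
Proof.
have [c c0 Tc] := adjop_bounded CS T.
move=> /cvg_rnorm ul; apply/cvg_rnorm => e e0.
apply: filterS (ul _ (divr_gt0 e0 c0)) => n ln.
by rewrite -linearB (le_lt_trans (Tc _)) // mulrC -ltr_pdivlMr.
Qed.

Lemma cvg_innerr x (u : nat -> H) (l : H) :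
  u @ \oo --> l -> inner x (u n) @[n --> \oo] --> inner x l.
Proof.
move=> /cvg_rnorm ul; apply/cvg_rnorm => e e0.
have x1 : 0 < rnorm x + 1 by rewrite ltr_wpDl ?rnorm_ge0.
apply: filterS (ul _ (divr_gt0 e0 x1)) => n; rewrite ltr_pdivlMr // => ln.
rewrite -innerNr -innerDr (le_lt_trans (CS _ _)) // (le_lt_trans _ ln) //.
by rewrite mulrC ler_wpM2l ?rnorm_ge0 // lerDl.
Qed.

Lemma cvg_innerl x (u : nat -> H) (l : H) :
  u @ \oo --> l -> inner (u n) x @[n --> \oo] --> inner l x.
Proof.
move=> /cvg_rnorm ul; apply/cvg_rnorm => e e0.
have x1 : 0 < rnorm x + 1 by rewrite ltr_wpDl ?rnorm_ge0.
apply: filterS (ul _ (divr_gt0 e0 x1)) => n; rewrite ltr_pdivlMr // => ln.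
have -> : inner l x - inner (u n) x = inner (l - u n) x.
  by rewrite innerDl innerNl.
rewrite (le_lt_trans (CS _ _)) // (le_lt_trans _ ln) //.
by rewrite ler_wpM2l ?rnorm_ge0 // lerDl.
Qed.

(** [1 - w] is a square root of [1 - y].  The iterates [w n] commute with
    everything that commutes with [y]; they and their increments are dominated
    by the scalar iteration [t n] for [y = 1], which increases and stays below
    1.  So the case [||y|| = 1], where the iteration is not a contraction, is
    covered as well. *)
Lemma op_one_sub_sqrt (y : adjop H) : adj y = y -> opbound y 1 ->
  exists w, [/\ adj w = w, opbound w 1, w + w = y + w * w
    & forall t, t * y = y * t -> t * w = w * t].
Proof.
move=> ysa y1.
pose fix w n := if n is m.+1 then (2^-1 : R)%:C *: (y + w m * w m) else 0 : adjop H.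
pose fix t n : R := if n is m.+1 then 2^-1 * (1 + t m * t m) else 0.
have half_ge0 : 0 <= 2^-1 :> R by rewrite invr_ge0.
have t01 n : 0 <= t n <= 1 by elim: n => [|n /andP[t0 t1]] /=; [lra|nra].
have wsa n : adj (w n) = w n.
  by elim: n => [|n IHn] /=; [exact: adj0|
    rewrite adjZr adjD adjM IHn ysa].
have wt n : opbound (w n) (t n).
  elim: n => [|n IHn] /=; first by move=> a; rewrite mul0r adjop0x rnorm0.
  apply: opboundZ => //; apply: opboundD => //.
  by apply: opboundM => //; case/andP: (t01 n).
have dw n : opbound (w n.+1 - w n) (t n.+1 - t n).
  elim: n => [|n IHn].
    rewrite /= !subr0 !mulr0 !addr0; exact: opboundZ.
  have -> : w n.+2 - w n.+1 = (2^-1 : R)%:C *: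
      (w n.+1 * (w n.+1 - w n) + (w n.+1 - w n) * w n).
    rewrite [w n.+2]/= [in X in _ - X]/= -scalerBr; congr (_ *: _).
    by rewrite opprD addrACA subrr add0r mulrBr mulrBl addrA subrK.
  have -> : t n.+2 - t n.+1 = 2^-1 *
      (t n.+1 * (t n.+1 - t n) + (t n.+1 - t n) * t n) by rewrite /=; lra.
  apply: opboundZ => //; apply: opboundD; apply: opboundM => //.
    by case/andP: (t01 n.+1).
  by move: (t01 n) => /andP[? ?] /=; nra.
have wcomm s n : s * y = y * s -> s * w n = w n * s.
  move=> sy; elim: n => [|n IHn] /=; first by rewrite mulr0 mul0r.
  by rewrite adjopZr adjopZl mulrDr mulrDl sy mulrA IHn -!mulrA IHn.
have /choice[wl wlP] x : exists l, (w n x @[n --> \oo] --> l) /\ rnorm l <= rnorm x.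
  have [|n|l wl lb] := @cvg_telescope _ H (fun n => w n x)
      (fun n => t n * rnorm x) (rnorm x).
  - by move=> n; rewrite -mulrBl; exact: dw.
  - by rewrite ler_piMl ?rnorm_ge0 //; case/andP: (t01 n).
  - by exists l; split=> //; have := lb 0%N; rewrite /= mul0r !subr0.
have wl_sa : is_adjoint wl wl.
  move=> a b; apply: (@cvg_unique _ (@norm_hausdorff _ A)
    (inner (w n a) b @[n --> \oo])).
    by apply: cvg_innerl; case: (wlP a).
  have -> : (fun n => inner (w n a) b) = (fun n => inner a (w n b)).
    by apply/funext => n; rewrite adjE wsa.
  by apply: cvg_innerr; case: (wlP b).
have wl_adj : wl \in @adjointable _ _ H by apply/asboolP; exists wl.
pose W : adjop H := AdjOp wl_adj.
have W1 : opbound W 1 by move=> a; rewrite mul1r; case: (wlP a).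
have wn1 n : opbound (w n) 1 by apply: opbound_le (wt n); case/andP: (t01 n).
exists W; split=> //.
- exact: adj_unique.
- apply: adjopP => x.
  apply: (@cvg_unique _ (@norm_hausdorff _ H) (w n.+1 x + w n.+1 x @[n --> \oo])).
    have wS : w n.+1 x @[n --> \oo] --> wl x.
      by rewrite (cvg_shiftS (fun n => w n x)); case: (wlP x).
    exact: cvgD.
  have -> : (fun n => w n.+1 x + w n.+1 x) = (fun n => y x + w n (w n x)).
    apply/funext => n; rewrite [w n.+1]/= !adjopZx -scalerDl -rmorphD /=.
    by rewrite (_ : 2^-1 + 2^-1 = 1) ?scale1r //; lra.
  apply: cvgD; first exact: cvg_cst.
  apply/cvg_rnorm => e e0; have e20 : 0 < e / 2 by lra.
  have /cvg_rnorm/(_ _ e20) c1 := (wlP x).1.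
  have /cvg_rnorm/(_ _ e20) c2 := (wlP (wl x)).1.
  apply: filterS2 c1 c2 => n c1 c2.
  have := rnormD3 (w n (wl x)) (wl (wl x)) (w n (w n x)).
  by rewrite -linearB /= => c3; have := wn1 n (wl x - w n x); lra.
- move=> s sy; apply: adjopP => x.
  apply: (@cvg_unique _ (@norm_hausdorff _ H) (s (w n x) @[n --> \oo])).
    by apply: cvg_adjop; case: (wlP x).
  have -> : (fun n => s (w n x)) = (fun n => w n (s x)).
    by apply/funext => n; rewrite -!adjopMx wcomm.
  by case: (wlP (s x)).
Qed.

End SquareRoots.

(** * Positive operators *)

Lemma conj_i (R : realType) : ('i : R[i])^*%R = - 'i.
Proof. by apply/eqP; rewrite eq_complex /= oppr0 !eqxx. Qed.

Lemma one_sub_sqr (S : pzRingType) (w y : S) :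
  w + w = y + w * w -> (1 - w) * (1 - w) = 1 - y.
Proof.
move=> wE; rewrite mulrBl mul1r mulrBr mulr1 opprB addrACA -opprD wE.
by rewrite [y + _]addrC addrKA.
Qed.

Lemma double_sqrD (S : pzRingType) (g : S) :
  (g * g + g * g) * (g * g + g * g) + g * (1 - g * g) * (g * (1 - g * g)) =
  g * (1 + g * g) * (g * (1 + g * g)).
Proof.
rewrite [g * (1 - _)]mulrBr [g * (1 + _)]mulrDr mulr1.
set b := g * (g * g); have bg : b * g = g * b by rewrite /b !mulrA.
rewrite mulrBl !mulrBr !mulrDl !mulrDr bg.
have -> : g * g * (g * g) = g * b by rewrite /b !mulrA.
rewrite opprB [X in _ + X = _]addrACA -opprD [LHS]addrC [LHS]addrA subrK.
by rewrite [g * b + b * b]addrC addrACA.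
Qed.

Lemma sqrD_sub (S : pzRingType) (z t : S) :
  (z + t) * (z + t) - (z - t) * (z - t) = (z * t + z * t) + (t * z + t * z).
Proof.
rewrite [(z - t) * _]mulrBl !mulrBr mulrDl !mulrDr !opprB.
rewrite [X in _ + X = _]addrC addrACA [z * z + _]addrC.
rewrite [X in X + _ = _]addrACA subrr addr0.
by rewrite [X in _ + X = _]addrACA subrr addr0.
Qed.

Section Positivity.
Variables (R : realType) (A : cstarAlgType R) (H : hilbertModType A).
Hypothesis CS : cauchy_schwarz H.
Implicit Types (x y : H) (T S h g k l z : adjop H) (c : R).

(** The operator [u = k + i l] satisfies [u^* u = k^2 + l^2], and [k] is its real
    part. *)
Lemma opbound_comm_sq k l c : adj k = k -> adj l = l -> k * l = l * k ->
  0 <= c -> opbound (k * k + l * l) (c ^+ 2) -> opbound k c.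
Proof.
move=> ksa lsa kl c0 klc; pose u := k + 'i *: l.
have adju : adj u = k - 'i *: l.
  rewrite adjD ksa adjZ lsa -scaleNr; congr (_ + _ *: _); exact: conj_i.
have uc : opbound u c.
  apply: (opbound_cstar CS) => //.
  suff -> : adj u * u = k * k + l * l by [].
  rewrite adju /u mulrBl !mulrDr !adjopZr !adjopZl kl opprD addrA addrK scalerA.
  by rewrite -[_ * 'i]expr2 sqr_i scaleN1r opprK.
have -> : k = (2^-1 : R)%:C *: (u + adj u).
  rewrite adju /u addrACA subrr addr0 scalerDr -scalerDl -rmorphD /=.
  by rewrite (_ : 2^-1 + 2^-1 = 1) ?scale1r //; lra.
have -> : c = 2^-1 * (c + c) by lra.
by apply: opboundZ; rewrite ?invr_ge0 //; apply: opboundD => //; exact: opbound_adj.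
Qed.

(** With [d = sqrt (1 - T^2)] one has [T^2 + d^2 = 1], so that [d] is a
    contraction, and so is [d^2]. *)
Lemma opbound_one_sub_sq T : adj T = T -> opbound T 1 -> opbound (1 - T * T) 1.
Proof.
move=> Tsa T1.
have TT1 : opbound (T * T) 1 by exact: opboundM1.
have [|w [wsa w1 wE wcomm]] := op_one_sub_sqrt CS _ TT1; first by rewrite adjM Tsa.
have dd : (1 - w) * (1 - w) = 1 - T * T.
  exact: one_sub_sqr wE.
have d1 : opbound (1 - w) 1.
  apply: (@opbound_comm_sq _ T) => //.
  - by rewrite adjB adj1 wsa.
  - by rewrite mulrBl mulrBr mul1r mulr1 wcomm // mulrA.
  - by rewrite dd subrK expr1n; exact: opbound1.
by rewrite -dd; exact: opboundM1.
Qed.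

(** The norm condition says that the spectrum of the self-adjoint [h] is
    nonnegative.  Unlike the existence of a square root, it is visibly stable
    under sums. *)
Definition pos_op h :=
  adj h = h /\ exists2 c : R, 0 < c & opbound (c%:C *: (1 : adjop H) - h) c.

Lemma pos_op_sq k : adj k = k -> pos_op (k * k).
Proof.
move=> ksa; split; first by rewrite adjM ksa.
have [c c0 kc] := adjop_bounded CS k; exists (c ^+ 2); first exact: exprn_gt0.
pose k' := (c^-1)%:C *: k.
have k1 : opbound k' 1.
  exact: opbound_normalize.
have k'sa : adj k' = k' by rewrite adjZr ksa.
have -> : (c ^+ 2)%:C *: (1 : adjop H) - k * k = (c ^+ 2)%:C *: (1 - k' * k').
  rewrite scalerBr /k' adjopZr adjopZl !scalerA -!rmorphM /=.
  by rewrite [X in X%:C *: (k * k)](_ : _ = 1) ?scale1r //; field; exact: lt0r_neq0.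
rewrite -[X in opbound _ X]mulr1; apply: opboundZ; first by rewrite exprn_ge0 ?ltW.
exact: opbound_one_sub_sq.
Qed.

Lemma pos_opD h g : pos_op h -> pos_op g -> pos_op (h + g).
Proof.
move=> [hsa [c c0 hc]] [gsa [d d0 gd]]; split; first by rewrite adjD hsa gsa.
exists (c + d); first exact: addr_gt0.
by rewrite rmorphD scalerDl opprD addrACA; exact: opboundD.
Qed.

Lemma pos_opZ (r : R) h : 0 < r -> pos_op h -> pos_op (r%:C *: h).
Proof.
move=> r0 [hsa [c c0 hc]]; split; first by rewrite adjZr hsa.
exists (r * c); first exact: mulr_gt0.
rewrite rmorphM -scalerA -scalerBr.
by apply: opboundZ => //; exact: ltW.
Qed.

Lemma pos_op_sub h c : adj h = h -> 0 < c -> opbound h c ->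
  pos_op (c%:C *: (1 : adjop H) - h).
Proof.
move=> hsa c0 hc; split; first by rewrite adjB adjZr adj1 hsa.
by exists c => //; rewrite opprB addrC subrK.
Qed.

(** The root is [sqrt c (1 - w)], where [(1 - w)^2 = 1 - y] for
    [y = (c - h) / c].  It commutes with the commutant of [h], and it is itself
    positive, so that roots can be iterated. *)
Lemma pos_op_sqrt h : pos_op h -> exists r,
  [/\ adj r = r, r * r = h, pos_op r & forall t, t * h = h * t -> t * r = r * t].
Proof.
move=> [hsa [c c0 hc]].
pose y := (c^-1)%:C *: (c%:C *: (1 : adjop H) - h).
have ysa : adj y = y by rewrite adjZr adjB adjZr adj1 hsa.
have y1 : opbound y 1.
  exact: opbound_normalize.
have [w [wsa w1 wE wcomm]] := op_one_sub_sqrt CS ysa y1.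
have sc : 0 < Num.sqrt c by rewrite sqrtr_gt0.
exists ((Num.sqrt c)%:C *: (1 - w)); split.
- by rewrite adjZr adjB adj1 wsa.
- rewrite adjopZr adjopZl scalerA -rmorphM /= -expr2 sqr_sqrtr ?ltW //.
  rewrite (one_sub_sqr wE) scalerBr scalerA -rmorphM /= mulfV ?lt0r_neq0 //.
  by rewrite rmorph1 scale1r opprB addrC subrK.
- apply: pos_opZ => //; split; first by rewrite adjB adj1 wsa.
  by exists 1 => //; rewrite rmorph1 scale1r opprB addrC subrK.
- move=> t th; rewrite adjopZr adjopZl mulrBr mulrBl mul1r mulr1 wcomm //.
  by rewrite /y adjopZr adjopZl mulrBr mulrBl adjopZr adjopZl mul1r mulr1 th.
Qed.

(** Both [h = k^2] and [c - h = l^2] are positive, and their roots commute, so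
    [k^2 + l^2 = c] bounds [k]. *)
Lemma opbound_mono h g c : pos_op h -> pos_op (g - h) -> 0 < c ->
  opbound g c -> opbound h c.
Proof.
move=> ph pgh c0 gc.
have gsa : adj g = g.
  by case: ph pgh => [hsa _] [ghsa _]; rewrite -(subrK h g) adjD ghsa hsa.
have pch : pos_op (c%:C *: (1 : adjop H) - h).
  rewrite -(subrK g (c%:C *: (1 : adjop H))) -addrA.
  by apply: pos_opD => //; exact: pos_op_sub.
have [k [ksa kk _ _]] := pos_op_sqrt ph.
have [l [lsa ll _ lcomm]] := pos_op_sqrt pch.
have kc : opbound k (Num.sqrt c).
  apply: (@opbound_comm_sq _ l) => //; last 2 first.
  - exact: sqrtr_ge0.
  - rewrite kk ll addrC subrK sqr_sqrtr ?ltW // -[X in opbound _ X]mulr1.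
    by apply: opboundZ; [exact: ltW|exact: opbound1].
  - by apply: lcomm; rewrite mulrBl mulrBr adjopZl adjopZr mul1r mulr1 -kk mulrA.
rewrite -kk -(sqr_sqrtr (ltW c0)) expr2; apply: opboundM => //; exact: sqrtr_ge0.
Qed.

(** Let [z] be a contraction and [z z^* = k^2].  From [z^* z = - g^2] one gets
    [z (1 + g^2) = (1 - k^2) z], where [1 - k^2] is a
    contraction; applied twice, this bounds [g^2 (1 + g^2)^2] by 1, that is
    [||g (1 + g^2)|| <= 1].  The identity
    [(g (1 + g^2))^2 = (g (1 - g^2))^2 + (2 g^2)^2] then gives
    [||2 g^2|| <= 1], which improves the bound 1 on [||z||^2] to 1/2. *)
Lemma anti_pos_shrink z g : adj g = g -> adj z * z = - (g * g) ->
  pos_op (z * adj z) -> opbound z 1 -> opbound ((Num.sqrt 2 : R)%:C *: z) 1.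
Proof.
move=> gsa zg pz z1.
have [k [ksa kk _ _]] := pos_op_sqrt pz.
have za1 : opbound (adj z) 1 by apply: opbound_adj.
have kk1 : opbound (k * k) 1 by rewrite kk; exact: opboundM1.
have e1 : opbound (1 - k * k) 1.
  apply: opbound_one_sub_sq => //; apply: (opbound_cstar CS) => //.
  by rewrite ksa expr1n.
pose f : adjop H := 1 + g * g; pose e : adjop H := 1 - k * k.
have zf : z * f = e * z.
  by rewrite mulrDr mulrBl mulr1 mul1r kk -mulrA zg mulrN opprK.
have gf : f * g = g * f by rewrite mulrDl mulrDr mul1r mulr1 mulrA.
have fsa : adj f = f by rewrite adjD adjM adj1 gsa.
have X1 : opbound (g * f) 1.
  apply: (opbound_cstar CS) => //; rewrite expr1n adjM fsa gsa.
  have -> : f * g * (g * f) = - (adj z * (e * (e * z))).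
    rewrite -zf [e * _]mulrA -zf !mulrA zg !mulNr opprK gf.
    by rewrite -[g * f * g]mulrA gf !mulrA.
  by apply: opboundN; do 3?apply: opboundM1.
have g21 : opbound (g * g + g * g) 1.
  apply: (@opbound_comm_sq _ (g * (1 - g * g))) => //.
  - by rewrite adjD adjM gsa.
  - by rewrite adjM adjB adjM adj1 gsa mulrBl mulrBr mul1r mulr1 mulrA.
  - have gy : GRing.comm (g * g + g * g) g.
      by apply/commr_sym/commrD; apply: commrM.
    apply: (commrM gy); apply: commrB; first exact: commr1.
    exact: commrM.
  - by rewrite double_sqrD expr1n; exact: opboundM1.
apply: (opbound_cstar CS) => //; rewrite expr1n adjZr.
rewrite adjopZl adjopZr scalerA -rmorphM /=.
rewrite -expr2 sqr_sqrtr // zg rmorph_nat scaler_nat mulr2n -opprD.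
exact: opboundN.
Qed.

(** No nonzero [z] has [z^* z] negative and [z z^*] positive: after rescaling, the
    norm of [z] could be divided by [sqrt 2] over and over. *)
Lemma anti_pos_eq0 z g : adj g = g -> adj z * z = - (g * g) ->
  pos_op (z * adj z) -> z = 0.
Proof.
move=> gsa zg pz.
(* The hypotheses are stable under scaling. *)
pose P z := exists2 g, adj g = g & adj z * z = - (g * g) /\ pos_op (z * adj z).
have PZ (r : R) z' : 0 < r -> P z' -> P (r%:C *: z').
  move=> r0 [g' g'sa [zg' pz']]; exists (r%:C *: g'); first by rewrite adjZr g'sa.
  rewrite adjZr !adjopZl !adjopZr !scalerA zg' scalerN -rmorphM; split=> //.
  by apply: pos_opZ => //; exact: mulr_gt0.
have Pn n z' : P z' -> opbound z' 1 -> opbound ((Num.sqrt 2 ^+ n : R)%:C *: z') 1.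
  elim: n z' => [|n IHn] z' Pz' w1; first by rewrite expr0 scale1r.
  rewrite exprSr rmorphM -scalerA; apply: IHn; first by apply: PZ; rewrite ?sqrtr_gt0.
  by case: Pz' => g' g'sa [zg' pz']; exact: anti_pos_shrink zg' pz' w1.
have [c c0 zc] := adjop_bounded CS z.
have Pz : P ((c^-1)%:C *: z) by apply: PZ; rewrite ?invr_gt0 //; exists g.
have /Pn z1 : opbound ((c^-1)%:C *: z) 1.
  exact: opbound_normalize.
apply: adjopP => x; apply/rnorm_eq0/eqP.
rewrite -[_ == _]negbK; apply/negP => zx.
have zx0 : 0 < rnorm (z x) by rewrite lt_neqAle rnorm_ge0 eq_sym zx.
have nb n : n%:R * rnorm (z x) <= c * rnorm x.
  have := z1 n.*2 Pz x; rewrite scalerA adjopZx -rmorphM rnormZ mul1r.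
  rewrite -mul2n exprM sqr_sqrtr // ger0_norm; last first.
    by rewrite mulr_ge0 ?exprn_ge0 ?invr_ge0 ?ltW.
  rewrite mulrAC ler_pdivrMr // [_ * c]mulrC; apply: le_trans.
  by rewrite ler_wpM2r ?rnorm_ge0 // -natrX ler_nat ltnW // ltn_expl.
have := nb (Num.truncn (c * rnorm x / rnorm (z x))).+1.
by rewrite -ler_pdivlMr // leNgt truncnS_gt.
Qed.

(** Kaplansky's argument.  Let [a = T^* T], [s = |a|] and let [n = s - a] be twice
    the negative part of [a].  Then [z = T n] has [z^* z = n a n = - s n^2],
    which is minus a square, while [z z^* + z^* z] is a sum of two squares.
    Hence [z z^*] is positive, [z = 0], [n = 0] and [a = s]. *)
Lemma pos_op_cstar T : pos_op (adj T * T).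
Proof.
set a := adj T * T.
have asa : adj a = a by rewrite /a adjM adjK.
have [s [ssa ss ps scomm]] := pos_op_sqrt (pos_op_sq asa).
have sa : a * s = s * a by apply: scomm; rewrite mulrA.
have [r [rsa rr _ rcomm]] := pos_op_sqrt ps.
pose n := s - a.
have nsa : adj n = n by rewrite adjB ssa asa.
have na : n * a = - (s * n) by rewrite mulrBl mulrBr ss opprB.
have ns : n * s = s * n by rewrite mulrBl mulrBr sa.
have nr : n * r = r * n by exact: rcomm.
pose z := T * n.
have zz : adj z * z = - ((r * n) * (r * n)).
  rewrite /z adjM nsa mulrA -[n * adj T * T]mulrA -/a na mulNr; congr (- _).
  by rewrite -rr -!mulrA; congr (_ * _); rewrite !mulrA nr.
have z0 : z = 0.
  apply: (@anti_pos_eq0 _ (r * n) _ zz); first by rewrite adjM rsa nsa nr.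
  (* Twice the real and the imaginary parts of [z], up to sign. *)
  pose p := z + adj z; pose q := 'i *: (z - adj z).
  have psa : adj p = p by rewrite adjD adjK addrC.
  have qsa : adj q = q.
    by rewrite adjZ conj_i adjB adjK scaleNr -scalerN opprB.
  have pos2 : pos_op (2%:C *: (z * adj z)).
    suff -> : 2%:C *: (z * adj z) = p * p + q * q + (r * n * (r * n) + r * n * (r * n)).
      have gsa : adj (r * n) = r * n by rewrite adjM rsa nsa.
      by do !apply: pos_opD; apply: pos_op_sq.
    rewrite /p /q adjopZr adjopZl scalerA -['i * 'i]expr2 sqr_i scaleN1r.
    by rewrite sqrD_sub zz -opprD subrK rmorph_nat scaler_nat mulr2n.
  have := pos_opZ (r := 2^-1) _ pos2.
  rewrite scalerA -rmorphM /= mulVf ?pnatr_eq0 // rmorph1 scale1r.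
  by apply; rewrite invr_gt0.
have an : a * n = 0 by rewrite /a -mulrA -/z z0 mulr0.
have na0 : n * a = 0.
  by rewrite -[n * a]adjK adjM nsa asa an adj0.
have n0 : n = 0.
  apply: adjopP => x; apply: rnorm_eq0; apply: le_anti; rewrite rnorm_ge0 andbT.
  have : opbound n 0.
    apply: (opbound_cstar CS) => //; rewrite nsa {1}/n mulrBl an subr0.
    have -> : s * n = 0 by rewrite -[s * n]opprK -na na0 oppr0.
    by move=> y; rewrite adjop0x rnorm0 mulr_ge0 ?rnorm_ge0 ?exprn_ge0.
  by move/(_ x); rewrite mul0r.
by move/eqP: n0; rewrite subr_eq0 => /eqP <-.
Qed.

End Positivity.

(** * The Cauchy-Schwarz inequality *)

Section CauchySchwarz.
Variables (R : realType) (A : cstarAlgType R).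
Implicit Types (a b c : A).

(** An alias for [A], that carries the structure of a right module over [A]
    itself, with [<a, b> = a^* b]. *)
Definition regmod : Type := A.

HB.instance Definition _ := CompleteNormedModule.copy regmod A.

Fact regmod_inner_star a b : star (cmul (star a) b) = cmul (star b) a.
Proof. by rewrite starM starK. Qed.

Fact regmod_inner_eq0 a : cmul (star a) a = 0 -> a = 0.
Proof.
move=> aa0; apply/eqP; rewrite -normr_eq0 -sqrf_eq0 -norm_cstar aa0.
by rewrite normr0.
Qed.

HB.instance Definition _ := isHilbertModule.Build R A regmod
  (fun x y a => cmulDl x y a) (fun x a b => cmulDr x a b)
  (fun x a b => cmulA x a b)
  (fun k x a => cmulZl k x a) (fun k x a => cmulZr k x a)
  (fun x y z => cmulDr (star x) y z) (fun k x y => cmulZr k (star x) y)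
  (fun x y a => cmulA (star x) y a) regmod_inner_star
  (fun x => ex_intro _ x erefl) regmod_inner_eq0
  (fun x => esym (norm_cstar x)).

Lemma rnorm_cmul a b : rnorm (cmul a b) <= rnorm a * rnorm b.
Proof. by rewrite -lecR rmorphM /= -!rnormE norm_cmul. Qed.

Lemma rnorm_cstar a : rnorm (cmul (star a) a) = rnorm a ^+ 2.
Proof. by apply: complexI; rewrite rmorphXn /= -!rnormE norm_cstar. Qed.

Lemma rnorm_star a : rnorm (star a) = rnorm a.
Proof.
have le_star b : rnorm b <= rnorm (star b).
  have [->|b0] := eqVneq (rnorm b) 0; first exact: rnorm_ge0.
  rewrite -(@ler_pM2r _ (rnorm b)) ?lt_neqAle 1?eq_sym ?b0 ?rnorm_ge0 //.
  by rewrite -expr2 -rnorm_cstar rnorm_cmul.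
by apply/le_anti; rewrite le_star andbT -{2}(starK a) le_star.
Qed.

Lemma regmod_cauchy_schwarz : cauchy_schwarz regmod.
Proof. by move=> a b; rewrite -(rnorm_star a); exact: rnorm_cmul. Qed.

Fact lmul_is_adjoint a :
  is_adjoint (cmul a : regmod -> regmod) (cmul (star a)).
Proof. by move=> x y; rewrite /inner /= starM cmulA. Qed.

Fact lmul_adjointable a : (cmul a : regmod -> regmod) \in @adjointable _ _ regmod.
Proof. by apply/asboolP; exists (cmul (star a)); exact: lmul_is_adjoint. Qed.

(** Left multiplications embed [A], which need not be unital, isometrically into
    the unital algebra L(A). *)
Definition lmul a : adjop regmod := AdjOp (lmul_adjointable a).

Lemma lmulD a b : lmul (a + b) = lmul a + lmul b.
Proof. by apply: adjopP => x; exact: cmulDl. Qed.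

Lemma lmulZ (k : R[i]) a : lmul (k *: a) = k *: lmul a.
Proof. by apply: adjopP => x; exact: cmulZl. Qed.

Lemma lmulB a b : lmul (a - b) = lmul a - lmul b.
Proof. by rewrite -scaleN1r lmulD lmulZ scaleN1r. Qed.

Lemma lmulM a b : lmul (cmul a b) = lmul a * lmul b.
Proof. by apply: adjopP => x; rewrite /= -cmulA. Qed.

Lemma adj_lmul a : adj (lmul a) = lmul (star a).
Proof. exact/adj_unique/lmul_is_adjoint. Qed.

Lemma opbound_lmul a (r : R) : 0 <= r -> opbound (lmul a) r <-> rnorm a <= r.
Proof.
move=> r0; split=> [ar|ar x]; last first.
  by rewrite (le_trans (rnorm_cmul _ _)) // ler_wpM2r ?rnorm_ge0.
have [->//|a0] := eqVneq (rnorm a) 0.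
rewrite -(@ler_pM2r _ (rnorm a)) ?lt_neqAle 1?eq_sym ?a0 ?rnorm_ge0 //.
rewrite -{3}(rnorm_star a) -expr2 -{1}(rnorm_star a) -rnorm_cstar starK.
exact: ar.
Qed.

Variable H : hilbertModType A.

(** Let [a = <x, y>], [c = <x, x>], [s = ||x||^-2] and [v = y - x s a].  Then
    [<y, y> - s a^* a] is the sum of [<v, v>] and of
    [s^2 a^* (||x||^2 - c) a], and both are positive, the first one by
    definition of a Hilbert module and the second one because
    [||c|| = ||x||^2].  So [s ||a||^2 <= ||y||^2] by monotonicity of the norm. *)
Lemma hilbertmod_cauchy_schwarz : cauchy_schwarz H.
Proof.
have CSA := regmod_cauchy_schwarz.
move=> x y; set a := inner x y; set c := inner x x.
have [x0|x0] := eqVneq (rnorm x) 0.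
  by rewrite x0 mul0r /a (rnorm_eq0 x0) inner0l rnorm0.
have [y0|y0] := eqVneq (rnorm y) 0.
  by rewrite y0 mulr0 /a (rnorm_eq0 y0) inner0r rnorm0.
have {}x0 : 0 < rnorm x by rewrite lt_neqAle rnorm_ge0 eq_sym x0.
have {}y0 : 0 < rnorm y by rewrite lt_neqAle rnorm_ge0 eq_sym y0.
pose N := rnorm x ^+ 2; pose s := N^-1.
have N0 : 0 < N by exact: exprn_gt0.
have s0 : 0 < s by rewrite invr_gt0.
pose aa := cmul (star a) a; pose aca := cmul (star a) (cmul c a).
pose v := y - ract x (s%:C *: a).
have vE : inner y y - s%:C *: aa = inner v v + (s%:C *: aa - (s ^+ 2)%:C *: aca).
  have vr z : inner v z = inner y z - s%:C *: cmul (star a) (inner x z).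
    rewrite innerDl innerNl inner_ractl starZ cmulZl; congr (_ - _ *: _).
    exact: conjc_real.
  have vl t : inner t v = inner t y - s%:C *: cmul (inner t x) a.
    by rewrite innerDr innerNr inner_ract cmulZr.
  rewrite vr !vl -[inner y x]inner_star -/a -/c cmulDr.
  rewrite -[- (_ *: cmul c a)]scaleN1r 2!cmulZr.
  rewrite scaleN1r scalerBr scalerA -rmorphM -expr2 -/aca.
  by rewrite subrK.
have pv : pos_op (lmul (inner v v)).
  by have [b ->] := inner_ge0 v; rewrite lmulM -adj_lmul; exact: pos_op_cstar.
have csa : adj (lmul c) = lmul c by rewrite adj_lmul inner_star.
have pc : pos_op (N%:C *: (1 : adjop regmod) - lmul c).
  apply: pos_op_sub => //; apply/opbound_lmul; first exact: ltW.
  by rewrite rnorm_inner.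
have paca : pos_op (lmul (s%:C *: aa - (s ^+ 2)%:C *: aca)).
  have [m [msa mm _ _]] := pos_op_sqrt CSA pc.
  have -> : lmul (s%:C *: aa - (s ^+ 2)%:C *: aca) =
      (s ^+ 2)%:C *: (adj (m * lmul a) * (m * lmul a)).
    rewrite adjM msa mulrA -[_ * m * m]mulrA mm mulrBr mulrBl adjopZr adjopZl.
    rewrite mulr1 adj_lmul -!lmulM -[cmul (cmul _ c) a]cmulA.
    rewrite -lmulZ -lmulB -lmulZ scalerBr scalerA -rmorphM /=.
    by rewrite expr2 -mulrA /s mulVf ?lt0r_neq0 // mulr1.
  by apply: pos_opZ; [exact: exprn_gt0|exact: pos_op_cstar].
have aas : rnorm (s%:C *: aa) <= rnorm y ^+ 2.
  apply/opbound_lmul; first exact: exprn_ge0 (rnorm_ge0 _).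
  apply: (@opbound_mono _ _ _ CSA _ (lmul (inner y y))).
  - rewrite lmulZ lmulM -adj_lmul; apply: pos_opZ => //; exact: pos_op_cstar.
  - by rewrite -lmulB vE lmulD; exact: pos_opD.
  - exact: exprn_gt0.
  - by apply/opbound_lmul; [exact: exprn_ge0 (rnorm_ge0 _)|rewrite rnorm_inner].
rewrite -(@ler_pXn2r _ 2) ?nnegrE ?mulr_ge0 ?rnorm_ge0 //.
rewrite -rnorm_cstar exprMn -/N -ler_pdivrMl //.
by move: aas; rewrite rnormZ ger0_norm // ltW.
Qed.

End CauchySchwarz.

(** * Orthogonally complemented submodules *)

Section Complements.
Variables (R : realType) (A : cstarAlgType R) (H : hilbertModType A).
Implicit Types (x y z : H) (T S B C E F W U : adjop H) (M N : set H).

Let CS := @hilbertmod_cauchy_schwarz R A H.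

Lemma inner0_sym x y : inner x y = 0 -> inner y x = 0.
Proof.
by move=> xy0; rewrite -inner_star xy0 -(inner0l x) inner_star inner0r inner0l.
Qed.

Lemma closure_map T M N : (forall x, M x -> closure N (T x)) ->
  forall x, closure M x -> closure N (T x).
Proof.
move=> MN x /closure_rnorm Mx; apply/closure_rnorm => e e0.
have [c c0 Tc] := adjop_bounded CS T.
have [|y /MN /closure_rnorm Ny xy] := Mx (e / 2 / c); first by rewrite !divr_gt0.
have [|z Nz yz] := Ny (e / 2); first by rewrite divr_gt0.
exists z => //; have := rnormD3 (T y) (T x) z; rewrite -linearB.
have := Tc (x - y); rewrite ltr_pdivlMr // mulrC in xy.
by rewrite /= in yz xy * => ? ?; lra.
Qed.

(** [S - 1] is continuous and vanishes on the range of [T]. *)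
Lemma closure_fixed T S : S * T = T ->
  forall x, closure (range T) x -> S x = x.
Proof.
move=> ST x /closure_rnorm Mx.
apply/eqP; rewrite -subr_eq0; apply/eqP/rnorm_le0 => e e0.
have [c c0 Sc] := adjop_bounded CS (S - 1).
have [_ [y _ <-] xy] := Mx (e / c) (divr_gt0 e0 c0).
rewrite ltr_pdivlMr // mulrC in xy; apply: le_lt_trans xy.
have -> : S x - x = (S - 1) (x - T y); last exact: Sc.
have STy : S (T y) = T y by rewrite -adjopMx ST.
rewrite adjopDx adjopNx adjop1x linearB /= STy.
by rewrite opprB addrA subrK.
Qed.

Lemma inner_closure0 M x : (forall y, M y -> inner x y = 0) ->
  forall y, closure M y -> inner x y = 0.
Proof.
move=> xM y /closure_rnorm My; apply: rnorm_le0 => e e0.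
have x1 : 0 < rnorm x + 1 by rewrite ltr_wpDl ?rnorm_ge0.
have [z Mz yz] := My (e / (rnorm x + 1)) (divr_gt0 e0 x1).
rewrite -(subr0 (inner x y)) -(xM z Mz) -innerNr -innerDr.
rewrite (le_lt_trans (CS _ _)) //; move: yz; rewrite ltr_pdivlMr // mulrC.
by apply: le_lt_trans; rewrite ler_wpM2r ?rnorm_ge0 // lerDl.
Qed.

Lemma rnorm_ract x (a : A) : rnorm (ract x a) <= rnorm x * rnorm a.
Proof.
rewrite -(@ler_pXn2r _ 2) ?nnegrE ?mulr_ge0 ?rnorm_ge0 //.
rewrite -rnorm_inner inner_ract inner_ractl -cmulA (le_trans (rnorm_cmul _ _)) //.
rewrite rnorm_star exprMn -rnorm_inner mulrC expr2 mulrA ler_wpM2r ?rnorm_ge0 //.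
exact: rnorm_cmul.
Qed.

Lemma adjop_ract T x (a : A) : T (ract x a) = ract (T x) a.
Proof. by apply: inner_injl => z; rewrite inner_ract -!adjEl inner_ract. Qed.

Lemma closed_submodule_closure_range T : closed_submodule (closure (range T)).
Proof.
split.
- exact: closed_closure.
- by apply: subset_closure; exists 0; rewrite ?linear0.
- move=> k x y clx cly.
  have {clx} /closure_rnorm clx : closure (range T) (k *: x).
    have := @closure_map (k *: (1 : adjop H)) (range T) (range T) _ x clx; apply.
    move=> _ [z _ <-]; apply: subset_closure; exists (k *: z) => //.
    by rewrite linearZ.
  move/closure_rnorm: cly => cly; apply/closure_rnorm => e e0.
  have e2 : 0 < e / 2 by rewrite divr_gt0.
  have [_ [x' _ <-] xx'] := clx _ e2; have [_ [y' _ <-] yy'] := cly _ e2.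
  exists (T (x' + y')); first by exists (x' + y').
  rewrite linearD opprD addrACA (le_lt_trans (rnormD _ _)) //.
  by rewrite (splitr e) ltrD.
- move=> x a /closure_rnorm clx; apply/closure_rnorm => e e0.
  have a1 : 0 < rnorm a + 1 by rewrite ltr_wpDl ?rnorm_ge0.
  have [_ [y _ <-] xy] := clx (e / (rnorm a + 1)) (divr_gt0 e0 a1).
  exists (ract (T y) a); first by exists (ract y a) => //; rewrite adjop_ract.
  rewrite -scaleN1r -ractZl -ractDl scaleN1r (le_lt_trans (rnorm_ract _ _)) //.
  move: xy; rewrite ltr_pdivlMr //; apply: le_lt_trans.
  by rewrite ler_wpM2l ?rnorm_ge0 // lerDl.
Qed.

(** For [T] positive, [||c - T|| <= c], so [y = (x + (c - T) y) / (1 + c)] is a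
    fixed point problem for a contraction of ratio [c / (1 + c)]. *)
Lemma pos_op_one_add_surj T : pos_op T -> forall x, exists y, y + T y = x.
Proof.
move=> [Tsa [c c0 Tc]] x; set B := (X in opbound X) in Tc.
have c1 : 0 < 1 + c by rewrite addr_gt0.
pose r := (1 + c)^-1; pose q := c * r.
have rE : r * (1 + c) = 1 by rewrite mulVf ?lt0r_neq0.
have r0 : 0 < r by rewrite invr_gt0.
have q0 : 0 <= q by rewrite mulr_ge0 ?ltW.
have q1 : 1 - q = r by rewrite /q -rE; ring.
pose fix u n := if n is m.+1 then r%:C *: (x + B (u m)) else 0 : H.
have uq n : rnorm (u n.+1 - u n) <= q ^+ n * rnorm (u 1%N - u 0%N).
  elim: n => [|n IHn]; first by rewrite expr0 mul1r.
  rewrite [u n.+2]/= [in X in _ - X]/= -scalerBr opprD addrACA subrr add0r -linearB.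
  rewrite rnormZ gtr0_norm // exprS.
  apply: le_trans (ler_wpM2l (ltW r0) (Tc _)) _.
  by rewrite mulrA [r * c]mulrC -/q -mulrA ler_wpM2l.
pose t n := - (q ^+ n * rnorm (u 1%N - u 0%N) / r).
have [||l ul _] := @cvg_telescope _ H u t 0.
- move=> n; rewrite (le_trans (uq n)) // /t exprS.
  rewrite le_eqVlt; apply/orP; left; apply/eqP.
  by rewrite -[LHS]mulr1 -(mulfV (lt0r_neq0 r0)) -{1}q1; ring.
- by move=> n; rewrite /t oppr_le0 divr_ge0 ?(ltW r0) ?mulr_ge0 ?exprn_ge0 ?rnorm_ge0.
have lE : l = r%:C *: (x + B l).
  apply: (@cvg_unique _ (@norm_hausdorff _ H) (u n.+1 @[n --> \oo])).
    by have := ul; rewrite -(cvg_shiftS u).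
  apply: cvgZr; apply: cvgD; first exact: cvg_cst.
  exact: (cvg_adjop CS).
exists l; have : (1 + c)%:C *: l = x + B l.
  by rewrite [in LHS]lE scalerA -rmorphM mulrC rE rmorph1 scale1r.
rewrite /B adjopDx adjopNx adjopZx adjop1x rmorphD scalerDl rmorph1 scale1r.
move=> lE'; transitivity (l + c%:C *: l - (c%:C *: l - T l)).
  by rewrite opprB addrACA subrr addr0.
by rewrite lE' addrK.
Qed.

(** Let [X = E - E^*] and [G = E + E^* - 1].  Then [G^2 = 1 + X^* X], so every
    vector is of the form [G (G z) = E (G z) + (E^* - 1) (G z)], and
    [E^* (E^* - 1) = 0] puts the second term in the kernel of [E^*], which is the
    orthogonal complement of the range of [E]. *)
Lemma idempotent_orthocomplemented E :
  E * E = E -> orthocomplemented (closure (range E)).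
Proof.
move=> EE; split; first exact: closed_submodule_closure_range.
apply/seteqP; split=> // x _.
pose X := E - adj E; pose G := E + adj E - 1.
have aEE : adj E * adj E = adj E by rewrite -adjM EE.
have GG : G * G = 1 + adj X * X.
  have EF : (E + adj E) * (E + adj E) = adj E * E + E * adj E + (E + adj E).
    by rewrite mulrDl !mulrDr EE aEE [LHS]addrACA [E + adj E * E]addrC [LHS]addrACA.
  rewrite /X adjB adjK [RHS]addrC !(mulrBl, mulrBr) EE aEE mul1r !mulr1 EF addrK.
  rewrite !opprB [X in _ = X + 1]addrACA -opprD [adj E + E]addrC.
  by rewrite [1 - _]addrC addrA.
have [z <-] := pos_op_one_add_surj (pos_op_cstar CS X) x.
have -> : z + (adj X * X) z = E (G z) + (adj E - 1) (G z).
  by rewrite -adjopDx addrA -/G -adjopMx GG.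
exists (E (G z)); first by apply: subset_closure; exists (G z).
exists ((adj E - 1) (G z)) => //; apply: inner_closure0 => _ [y _ <-].
rewrite -adjEl -[adj E _]adjopMx mulrBr aEE mulr1 subrr adjop0x.
exact: inner0l.
Qed.

(** The component in [M] of a vector is unique, and the map that takes it is its
    own adjoint. *)
Lemma orthocomplemented_proj M :
  orthocomplemented M -> exists E, is_proj_onto M E.
Proof.
move=> [[_ M0 Mlin _] MT].
have /choice[e eP] x : exists m, M m /\ orthocompl M (x - m).
  have : setT x by []. rewrite -MT => -[m Mm [n Mn <-]].
  by exists m; rewrite addrAC subrr add0r.
have eadj : is_adjoint e e.
  have eM x y : inner (e x) y = inner (e x) (e y).
    have [_ /(_ (e x)) yM] := eP y; have [Mx _] := eP x.
    have := inner0_sym (yM Mx); rewrite innerDr innerNr => /eqP.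
    by rewrite subr_eq0 => /eqP.
  by move=> x y; rewrite eM -[RHS]inner_star [inner (e y) x]eM inner_star.
have eadj' : e \in @adjointable _ _ H by apply/asboolP; exists e.
pose E : adjop H := AdjOp eadj'.
have Eid x : M x -> e x = x.
  move=> Mx; have [Mex xe] := eP x.
  apply/esym/eqP; rewrite -subr_eq0; apply/eqP/inner_eq0/xe.
  by rewrite addrC -scaleN1r; exact: Mlin.
exists E; split; first split.
- by apply: adjopP => x; apply: Eid; case: (eP x).
- exact: adj_unique.
- apply/seteqP; split=> [_ [x _ <-]|x Mx]; first by case: (eP x).
  by exists x => //; exact: Eid.
Qed.

Lemma closure_range_idempotent F T : F * F = F -> F * T = T ->
  (forall x, closure (range T) (F x)) -> closure (range T) = range F.
Proof.
move=> FF FT TF; apply/seteqP; split=> [x clx|_ [x _ <-]] //.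
by exists x => //; exact: closure_fixed clx.
Qed.

Lemma orthocomplemented_closure_range F T : F * F = F -> F * T = T ->
  (forall x, closure (range T) (F x)) -> orthocomplemented (closure (range T)).
Proof.
move=> FF FT TF; have TFE := closure_range_idempotent FF FT TF.
rewrite TFE -[range F](_ : closure (range F) = _); last first.
  by apply: closure_range_idempotent => // x; apply: subset_closure; exists x.
exact: idempotent_orthocomplemented.
Qed.

(** Let [E] be the projection onto the closure [M] of the range of [W].  Since
    [B W = W C], the operator [B] maps [M] into itself; hence [B E] is an
    idempotent, and its range is the closure of the range of [B W]. *)
Lemma orthocomplemented_range_mul B C W :
  orthocomplemented (closure (range W)) -> B * B = B -> B * W = W * C ->
  orthocomplemented (closure (range (B * W))).
Proof.
move=> /orthocomplemented_proj[E [[EE _] EW]] BB BW.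
have WE x : closure (range W) (E x) by rewrite -EW; exists x.
have EWW : E * W = W.
  apply: adjopP => x; rewrite adjopMx.
  have [y _ <-] : range E (W x) by rewrite EW; apply: subset_closure; exists x.
  by rewrite -adjopMx EE.
have clBE x : closure (range (B * W)) ((B * E) x).
  apply: (closure_map _ (WE x)) => _ [y _ <-].
  by apply: subset_closure; exists y.
apply: (@orthocomplemented_closure_range (B * E)) => //.
- rewrite -mulrA.
  have -> : B * (E * (B * E)) = B * (B * E).
    congr (_ * _); apply: adjopP => x; apply: (closure_fixed _ (clBE x)).
    by rewrite BW mulrA EWW.
  by rewrite mulrA BB.
- by rewrite BW -mulrA (mulrA E) EWW -BW mulrA BB.
Qed.

End Complements.

(** * Polar decompositions *)

Section PolarDecomposition.
Variables (R : realType) (A : cstarAlgType R) (H : hilbertModType A).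
Implicit Types (x y z v : H) (T S E F U : adjop H).

Let CS := @hilbertmod_cauchy_schwarz R A H.

(** The closure of the relation [S y |-> T y].  When [S^* S = T^* T] this relation
    is isometric, so its closure is the graph of an isometry between the closures
    of the ranges of [S] and [T]. *)
Definition graph_closure S T x v := exists y : nat -> H,
  S (y n) @[n --> \oo] --> x /\ T (y n) @[n --> \oo] --> v.

Lemma graph_closure_inner S T x x' v v' : adj S * S = adj T * T ->
  graph_closure S T x v -> graph_closure S T x' v' -> inner x x' = inner v v'.
Proof.
move=> ST [y [Sy Ty]] [y' [Sy' Ty']].
have ips a b : inner (S a) (S b) = inner (T a) (T b).
  by rewrite !adjE -!adjopMx ST.
have xS m : inner x (S (y' m)) = inner v (T (y' m)).
  apply: (@cvg_unique _ (@norm_hausdorff _ A)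
    (inner (S (y n)) (S (y' m)) @[n --> \oo])).
    exact: cvg_innerl.
  have -> : (fun n => inner (S (y n)) (S (y' m))) =
      (fun n => inner (T (y n)) (T (y' m))).
    exact/funext.
  exact: cvg_innerl.
apply: (@cvg_unique _ (@norm_hausdorff _ A) (inner x (S (y' m)) @[m --> \oo])).
  exact: cvg_innerr.
have -> : (fun m => inner x (S (y' m))) = (fun m => inner v (T (y' m))).
  exact/funext.
exact: cvg_innerr.
Qed.

Lemma graph_closure_uniq S T x v v' : adj S * S = adj T * T ->
  graph_closure S T x v -> graph_closure S T x v' -> v = v'.
Proof.
move=> ST xv xv'; apply/eqP; rewrite -subr_eq0; apply/eqP/inner_eq0.
have g a b : graph_closure S T x a -> graph_closure S T x b -> inner a b = inner x x.
  by move=> xa xb; rewrite (graph_closure_inner ST xa xb).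
rewrite innerDr innerNr !innerDl !innerNl.
by rewrite (g v v) // (g v' v) // (g v v') // (g v' v') // !subrr.
Qed.

(** Choose [S (y n)] at distance less than [2^-n] from [x].  Since [T] and [S]
    induce the same seminorm, [T (y n.+1) - T (y n)] is of norm at most
    [2^-n + 2^-(n+1)], and this is less than the increment [2 * 2^-n] of
    [- 4 * 2^-n]. *)
Lemma graph_closure_ex S T x : adj S * S = adj T * T ->
  closure (range S) x -> exists v, graph_closure S T x v.
Proof.
move=> ST /closure_rnorm clx.
have nST a : rnorm (T a) = rnorm (S a).
  apply/eqP; rewrite -(@eqrXn2 _ 2) ?rnorm_ge0 // -!rnorm_inner.
  by rewrite !adjE -!adjopMx ST.
have q0 n : 0 < (2^-1 : R) ^+ n by rewrite exprn_gt0 // invr_gt0.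
have /choice[y yP] n : exists y, rnorm (x - S y) < 2^-1 ^+ n.
  by have [_ [y _ <-] xy] := clx _ (q0 n); exists y.
have [n|n|v Tv _] := @cvg_telescope _ H (fun n => T (y n))
  (fun n => - (4 * 2^-1 ^+ n)) 0.
- rewrite -linearB nST linearB /=.
  have := rnormD3 x (S (y n.+1)) (S (y n)); rewrite [rnorm (_ - x)]rnormB.
  by have := yP n.+1; have := yP n; rewrite exprS; have := q0 n; lra.
- by have := q0 n; lra.
exists v, y; split=> //; apply/cvg_rnorm => e e0.
exists (Num.truncn e^-1).+1 => // n /= en; apply: lt_trans (yP n) _.
rewrite exprVn -ltf_pV2 ?posrE ?invr_gt0 ?exprn_gt0 // invrK.
apply: lt_le_trans (truncnS_gt _) _; rewrite -natrX ler_nat.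
by rewrite (leq_trans en) // ltnW // ltn_expl.
Qed.

Lemma graph_closure_sym S T x v : graph_closure S T x v -> graph_closure T S v x.
Proof. by move=> [y [Sy Ty]]; exists y. Qed.

Lemma graph_closure_pt S T x : graph_closure S T (S x) (T x).
Proof. by exists (fun=> x); split; exact: cvg_cst. Qed.

Lemma graph_closure_fixed S T F x v :
  F * T = T -> graph_closure S T x v -> F v = v.
Proof.
move=> FT [y [_ Ty]].
apply: (@cvg_unique _ (@norm_hausdorff _ H) (T (y n) @[n --> \oo])) => //.
have -> : (fun n => T (y n)) = (fun n => F (T (y n))).
  by apply/funext => n; rewrite -adjopMx FT.
exact: cvg_adjop.
Qed.

Lemma proj_fixes_range T E : is_proj_onto (closure (range T)) E -> E * T = T.
Proof.
move=> [[EE _] ET]; apply: adjopP => x; rewrite adjopMx.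
have [y _ <-] : range E (T x) by rewrite ET; apply: subset_closure; exists x.
by rewrite -adjopMx EE.
Qed.

(** The partial isometry [U] sends [x] to the image of [E x] under the closure of
    [|T| y |-> T y], where [E] is the projection onto the closure of the range of
    [T^*], which is also that of [|T|].  The inverse relation, precomposed with
    the projection [F] onto the closure of the range of [T], defines the adjoint
    of [U]; this is where the range of [T] has to be complemented as well. *)
Lemma polar_decomposition T : orthocomplemented (closure (range T)) ->
  orthocomplemented (closure (range (adj T))) -> has_polar_decomposition T.
Proof.
move=> /orthocomplemented_proj[F [Fproj FT]] cT'; split=> //.
have [E [Eproj ET]] := orthocomplemented_proj cT'.
have [S [Ssa SS pS _]] := pos_op_sqrt CS (pos_op_cstar CS T).
have FTT : F * T = T by exact: proj_fixes_range.
have ETT : E * adj T = adj T by exact: proj_fixes_range.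
have [[EE Esa] [FF Fsa]] := (Eproj, Fproj).
have TE : T * E = T by rewrite -[T in LHS]adjK -{1}Esa -adjM ETT adjK.
have TF : adj T * F = adj T by rewrite -{1}Fsa -adjM FTT.
have ST : adj S * S = adj T * T by rewrite Ssa.
(* [S] vanishes on the kernel of [T], which contains the range of [1 - E]. *)
have SE : S * E = S.
  apply/eqP; rewrite -subr_eq0; apply/eqP/adjopP => x; apply: rnorm_eq0.
  have : opbound (S * E - S) 0.
    apply: (opbound_cstar CS) => //.
    have -> : adj (S * E - S) * (S * E - S) = 0.
      rewrite -{2 4}[S]mulr1 -mulrBr adjM Ssa -mulrA [S * (S * _)]mulrA SS.
      by rewrite -mulrA mulrBr TE mulr1 subrr !mulr0.
    by move=> y; rewrite adjop0x rnorm0 expr0n mul0r.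
  by move/(_ x); rewrite mul0r => ?; apply/le_anti; rewrite rnorm_ge0 andbT.
have ES : E * S = S by rewrite -[RHS]Ssa -[in RHS]SE adjM Esa Ssa.
have clS x : closure (range S) (E x).
  have : closure (range (adj T)) (E x) by rewrite -ET; exists x.
  rewrite -[E x]/((1 : adjop H) (E x)); move: (E x); apply: closure_map => _ [y _ <-].
  (* [T^* = T^* F], so [T^* y] is a limit of vectors [T^* T z = S (S z)]. *)
  rewrite adjop1x -TF adjopMx.
  have : closure (range T) (F y) by rewrite -FT; exists y.
  move: (F y); apply: closure_map => _ [z _ <-].
  by apply: subset_closure; exists (S z) => //; rewrite -!adjopMx SS.
have clT x : closure (range T) (F x) by rewrite -FT; exists x.
have /choice[u uP] x := graph_closure_ex ST (clS x).
have /choice[w wP] x := graph_closure_ex (esym ST) (clT x).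
have Fu x : F (u x) = u x by exact: graph_closure_fixed (uP x).
have Ew x : E (w x) = w x by exact: graph_closure_fixed (wP x).
have uw : is_adjoint u w.
  move=> x z; rewrite -(Fu x) adjE Fsa.
  by rewrite -(graph_closure_inner ST (uP x) (graph_closure_sym (wP z))) adjE Esa Ew.
have u_adj : u \in @adjointable _ _ H by apply/asboolP; exists w.
pose U : adjop H := AdjOp u_adj.
have adjU x : adj U x = w x by apply: inner_injl => z; rewrite -adjE; exact: uw.
have UU : adj U * U = E.
  apply: adjopP => x; rewrite adjopMx adjU.
  apply: (graph_closure_uniq (esym ST) (wP (u x))).
  by rewrite Fu; exact: graph_closure_sym.
have UE : U * E = U.
  apply: adjopP => x; apply: (graph_closure_uniq ST (uP (E x))).
  by rewrite -adjopMx EE; exact: uP.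
have US : U * S = T.
  apply: adjopP => x; apply: (graph_closure_uniq ST (uP (S x))).
  by rewrite -adjopMx ES; exact: graph_closure_pt.
exists U, S; split=> //.
- by rewrite /partial_isometry -mulrA UU.
- split=> //; have [r [rsa rr _ _]] := pos_op_sqrt CS pS.
  by exists r; rewrite rsa.
- by rewrite UU.
Qed.

(** [U U^*] is an idempotent onto the closure of the range of [T]. *)
Lemma polar_orthocomplemented T :
  has_polar_decomposition T -> orthocomplemented (closure (range T)).
Proof.
move=> [_ [U [S [UU [[S' SE] SS] TE [_ UT]]]]].
have Ssa : adj S = S by rewrite SE adjM adjK.
have UU' : adj U * U * adj U = adj U by rewrite -{4}UU !adjM adjK mulrA.
apply: (@orthocomplemented_closure_range _ _ _ (U * adj U)).
- by rewrite mulrA UU.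
- by rewrite {1}TE mulrA UU -TE.
- move=> x; rewrite adjopMx.
  have : closure (range (adj T)) (adj U x).
    by rewrite -UT; exists (adj U x) => //; rewrite -adjopMx UU'.
  move: (adj U x); apply: closure_map => _ [y _ <-].
  apply: subset_closure; exists (adj U y) => //.
  by rewrite -!adjopMx TE adjM Ssa mulrA.
Qed.

End PolarDecomposition.

(** * Quasi-projection pairs *)

Section QuasiProjectionPairs.
Variables (R : realType) (A : cstarAlgType R) (H : hilbertModType A).
Implicit Types (P Q X Y : adjop H).

(** The vector [l1^-1 (1 - Q) x + l2^-1 Q y] is a preimage of [T1 x + T2 y]. *)
Lemma range_comb P Q (l1 l2 : R[i]) : Q * Q = Q -> l1 != 0 -> l2 != 0 ->
  range (l1 *: (P * (1 - Q)) + l2 *: ((1 - P) * Q)) =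
  set_add (range (P * (1 - Q))) (range ((1 - P) * Q)).
Proof.
move=> QQ l10 l20; apply/seteqP; split=> [_ [x _ <-]|].
  exists ((P * (1 - Q)) (l1 *: x)); first by exists (l1 *: x).
  exists (((1 - P) * Q) (l2 *: x)); first by exists (l2 *: x).
  by rewrite adjopDx !adjopZx !linearZ.
move=> _ [_ [x _ <-] [_ [y _ <-] <-]].
have Q'Q : (1 - Q) * Q = 0 by rewrite mulrBl mul1r QQ subrr.
have QQ' : Q * (1 - Q) = 0 by rewrite mulrBr mulr1 QQ subrr.
have Q'Q' : (1 - Q) * (1 - Q) = 1 - Q by rewrite mulrBr mulr1 Q'Q subr0.
set T := l1 *: _ + _.
have TQ' : T * (l1^-1 *: (1 - Q)) = P * (1 - Q).
  rewrite adjopZr mulrDl !adjopZl -!mulrA Q'Q' QQ' mulr0 scaler0 addr0.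
  by rewrite scalerA mulVf // scale1r.
have TQ : T * (l2^-1 *: Q) = (1 - P) * Q.
  rewrite adjopZr mulrDl !adjopZl -!mulrA Q'Q QQ mulr0 scaler0 add0r.
  by rewrite scalerA mulVf // scale1r.
exists ((l1^-1 *: (1 - Q)) x + (l2^-1 *: Q) y) => //.
by rewrite linearD -TQ' -TQ.
Qed.

Lemma block_ext P X Y : P * X * P = P * Y * P ->
  P * X * (1 - P) = P * Y * (1 - P) -> (1 - P) * X * P = (1 - P) * Y * P ->
  (1 - P) * X * (1 - P) = (1 - P) * Y * (1 - P) -> X = Y.
Proof.
move=> h11 h12 h21 h22; have PP1 : P + (1 - P) = 1 by rewrite addrC subrK.
have dec Z : Z = P * Z * P + P * Z * (1 - P) +
    ((1 - P) * Z * P + (1 - P) * Z * (1 - P)).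
  by rewrite -!mulrDr PP1 !mulr1 -mulrDl PP1 mul1r.
by rewrite (dec X) (dec Y) h11 h12 h21 h22.
Qed.

(** With respect to [P], the blocks of [W] are [P - P Q P], [- P Q (1 - P)],
    [(1 - P) Q P] and [(1 - P) Q (1 - P)], and those of [W^*] are [P - P Q^* P],
    [P Q^* (1 - P)], [- (1 - P) Q^* P] and [(1 - P) Q^* (1 - P)].  They agree by
    the three axioms and the adjoint of the second one. *)
Lemma quasi_projection_sum_selfadjoint P Q : quasi_projection_pair P Q ->
  let W := P * (1 - Q) + (1 - P) * Q in adj W = W.
Proof.
move=> [[PP Psa] QQ h11 h12 h22] W.
have h21 : (1 - P) * adj Q * P = - ((1 - P) * Q * P).
  have := congr1 (@adj _ _ H) h12.
  by rewrite adjN !adjM adjB adj1 Psa adjK !mulrA => ->; rewrite opprK.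
have P'P : (1 - P) * P = 0 by rewrite mulrBl mul1r PP subrr.
have PP' : P * (1 - P) = 0 by rewrite mulrBr mulr1 PP subrr.
have P'P' : (1 - P) * (1 - P) = 1 - P by rewrite mulrBl PP' subr0 mul1r.
have PW : P * W = P - P * Q.
  by rewrite mulrDr !mulrA PP PP' mul0r addr0 mulrBr mulr1.
have P'W : (1 - P) * W = (1 - P) * Q.
  by rewrite mulrDr !mulrA P'P P'P' mul0r add0r.
have WP : adj W * P = P - adj Q * P.
  by rewrite -{1}Psa -adjM PW adjB adjM Psa.
have WP' : adj W * (1 - P) = adj Q * (1 - P).
  have P'sa : adj (1 - P) = 1 - P by rewrite adjB adj1 Psa.
  by rewrite -{1}P'sa -adjM P'W adjM P'sa.
apply: (@block_ext P); rewrite -[LHS]mulrA ?WP ?WP' ?PW ?P'W.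
- by rewrite mulrBr mulrBl mulrA h11 PP.
- by rewrite mulrA h12 mulrBl PP' sub0r.
- by rewrite mulrBr mulrA h21 P'P sub0r opprK.
- by rewrite mulrA h22.
Qed.

(** The ranges of [T1] and [T2] are orthogonal, since [P] fixes the first one and
    kills the second one.  So the projections onto their closures add up to the
    projection onto the closure of the range of [T1 + T2]. *)
Lemma orthocomplemented_diag P Q : P * P = P -> adj P = P -> Q * Q = Q ->
  orthocomplemented (closure (range (P * (1 - Q)))) ->
  orthocomplemented (closure (range ((1 - P) * Q))) ->
  orthocomplemented (closure (range (P * (1 - Q) + (1 - P) * Q))).
Proof.
move=> PP Psa QQ.
set T1 := P * (1 - Q); set T2 := (1 - P) * Q.
move=> /orthocomplemented_proj[E1 E1p] /orthocomplemented_proj[E2 E2p].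
have ET1 := proj_fixes_range E1p; have ET2 := proj_fixes_range E2p.
have [[EE1 E1sa] R1] := E1p; have [[EE2 E2sa] R2] := E2p.
have PT1 : P * T1 = T1 by rewrite mulrA PP.
have PT2 : P * T2 = 0 by rewrite mulrA mulrBr mulr1 PP subrr mul0r.
have PE1 : P * E1 = E1.
  apply: adjopP => x; apply: (closure_fixed PT1).
  by rewrite -R1; exists x.
have PE2 : P * E2 = 0.
  have P'E2 : (1 - P) * E2 = E2.
    apply: adjopP => x; rewrite adjopMx; apply: (@closure_fixed _ _ _ T2).
      by rewrite mulrBl mul1r PT2 subr0.
    by rewrite -R2; exists x.
  by rewrite -P'E2 mulrA mulrBr mulr1 PP subrr mul0r.
have E1P : E1 * P = E1 by rewrite -[RHS]E1sa -[in RHS]PE1 adjM Psa E1sa.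
have E12 : E1 * E2 = 0 by rewrite -E1P -mulrA PE2 mulr0.
have E2P : E2 * P = 0 by rewrite -E2sa -Psa -adjM PE2 adj0.
have E21 : E2 * E1 = 0 by rewrite -PE1 mulrA E2P mul0r.
have R12 : range (T1 + T2) = set_add (range T1) (range T2).
  by have := @range_comb P Q 1 1 QQ; rewrite !scale1r => ->; rewrite ?oner_neq0.
have [_ _ cllin _] := closed_submodule_closure_range (T1 + T2).
apply: (@orthocomplemented_closure_range _ _ _ (E1 + E2)).
- by rewrite mulrDl !mulrDr EE1 EE2 E12 E21 addr0 add0r.
- rewrite mulrDl !mulrDr ET1 ET2.
  have -> : E1 * T2 = 0 by rewrite -E1P -mulrA PT2 mulr0.
  have -> : E2 * T1 = 0 by rewrite /T1 mulrA E2P mul0r.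
  by rewrite addr0 add0r.
- move=> x; rewrite adjopDx -[E1 x]scale1r; apply: cllin.
    have : closure (range T1) (E1 x) by rewrite -R1; exists x.
    apply: closure_subset => y T1y; rewrite R12; exists y => //.
    by exists 0; [exists 0; rewrite ?linear0|rewrite addr0].
  have : closure (range T2) (E2 x) by rewrite -R2; exists x.
  apply: closure_subset => y T2y; rewrite R12.
  exists 0; first by exists 0; rewrite ?linear0.
  by exists y => //; rewrite add0r.
Qed.

(** [T1], [T2] and their adjoints are all of the form [B W = W C] with [B]
    idempotent, for [W = T1 + T2] self-adjoint. *)
Lemma quasi_projection_semi_harmonious P Q : quasi_projection_pair P Q ->
  semi_harmonious P Q <->
  orthocomplemented (closure (range (P * (1 - Q) + (1 - P) * Q))).
Proof.
move=> PQ; have Wsa := quasi_projection_sum_selfadjoint PQ; cbv zeta in Wsa.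
have [[PP Psa] QQ _ _ _] := PQ.
split=> [[/polar_orthocomplemented o1 /polar_orthocomplemented o2]|oW].
  exact: orthocomplemented_diag.
move: Wsa oW; set W := P * (1 - Q) + (1 - P) * Q => Wsa oW.
have PP' : P * (1 - P) = 0 by rewrite mulrBr mulr1 PP subrr.
have P'P : (1 - P) * P = 0 by rewrite mulrBl mul1r PP subrr.
have QQ' : Q * (1 - Q) = 0 by rewrite mulrBr mulr1 QQ subrr.
have Q'Q : (1 - Q) * Q = 0 by rewrite mulrBl mul1r QQ subrr.
have P'P' : (1 - P) * (1 - P) = 1 - P by rewrite mulrBl PP' subr0 mul1r.
have Q'Q' : (1 - Q) * (1 - Q) = 1 - Q by rewrite mulrBl QQ' subr0 mul1r.
have P'sa : adj (1 - P) = 1 - P by rewrite adjB adj1 Psa.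
have PW : P * W = P * (1 - Q) by rewrite mulrDr !mulrA PP PP' mul0r addr0.
have P'W : (1 - P) * W = (1 - P) * Q by rewrite mulrDr !mulrA P'P P'P' mul0r add0r.
have WQ' : W * (1 - Q) = P * (1 - Q).
  by rewrite mulrDl -!mulrA Q'Q' QQ' mulr0 addr0.
have WQ : W * Q = (1 - P) * Q by rewrite mulrDl -!mulrA Q'Q QQ mulr0 add0r.
have aT1 : adj (P * (1 - Q)) = W * P by rewrite -PW adjM Psa Wsa.
have aT2 : adj ((1 - P) * Q) = W * (1 - P) by rewrite -P'W adjM P'sa Wsa.
have aQ'W : adj (1 - Q) * W = W * P by rewrite -{1}Wsa -adjM WQ' aT1.
have aQW : adj Q * W = W * (1 - P) by rewrite -{1}Wsa -adjM WQ aT2.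
split; apply: polar_decomposition.
- by rewrite -PW; apply: (orthocomplemented_range_mul (C := 1 - Q) oW); rewrite // PW.
- rewrite aT1 -aQ'W; apply: (orthocomplemented_range_mul (C := P) oW) => //.
  by rewrite -adjM Q'Q'.
- by rewrite -P'W; apply: (orthocomplemented_range_mul (C := Q) oW); rewrite // P'W.
- rewrite aT2 -aQW; apply: (orthocomplemented_range_mul (C := 1 - P) oW) => //.
  by rewrite -adjM QQ.
Qed.

End QuasiProjectionPairs.

Theorem lemma3p9 (R : realType) (A : cstarAlgType R) (H : hilbertModType A)
    (P Q : adjop H) :
  quasi_projection_pair P Q ->
  let T1 := P * (1 - Q) in
  let T2 := (1 - P) * Q in
  let T (l1 l2 : R[i]) := l1 *: T1 + l2 *: T2 in
  (forall l1 l2 : R[i], l1 != 0 -> l2 != 0 ->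
     range (T l1 l2) = set_add (range T1) (range T2)) /\
  (semi_harmonious P Q <->
   (forall l1 l2 : R[i], l1 != 0 -> l2 != 0 ->
      orthocomplemented (closure (range (T l1 l2))))) /\
  ((forall l1 l2 : R[i], l1 != 0 -> l2 != 0 ->
      orthocomplemented (closure (range (T l1 l2)))) <->
   (exists l1 l2 : R[i], [/\ l1 != 0, l2 != 0 &
      orthocomplemented (closure (range (T l1 l2)))])).
Proof.
move=> PQ T1 T2 T; have [_ QQ _ _ _] := PQ.
have RT (l1 l2 : R[i]) : l1 != 0 -> l2 != 0 ->
    range (T l1 l2) = set_add (range T1) (range T2) by exact: range_comb.
have RT1 : range (T1 + T2) = set_add (range T1) (range T2).
  by rewrite -(RT 1 1) ?oner_neq0 // /T !scale1r.
split; first exact: RT.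
split; split.
- by move=> /(quasi_projection_semi_harmonious PQ) oW l1 l2 l10 l20; rewrite RT // -RT1.
- move=> oT; apply/(quasi_projection_semi_harmonious PQ); rewrite -/T1 -/T2 RT1.
  by rewrite -(RT 1 1) ?oner_neq0 //; apply: oT; rewrite oner_neq0.
- by move=> oT; exists 1, 1; split; rewrite ?oner_neq0 //; apply: oT; rewrite oner_neq0.
- by move=> [k1 [k2 [k10 k20 oT]]] l1 l2 l10 l20; rewrite RT // -(RT k1 k2).
Qed.
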